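(* For the perturbed measure $e^{t(z)}\prod_{a=1}^{2D}(L_{n_a}(z)-q_a)^{m_a}d\mu$ on $\mathbb{T}^D$ (assumed quasi-definite for all parameters considered), the first subdiagonal matrices $\beta$ and $\hat\beta$ satisfy, for all $a,b\in\{1,\dots,2D\}$, the nonlinear equations $$\Delta_b\Big[\partial_{n_a}\beta+(\Delta_a\beta)\big(q_a+(\nu_a)_\ge\beta\big)\Big](\nu_b)_\ge=\Delta_a\Big[\partial_{n_b}\beta+(\Delta_b\beta)\big(q_b+(\nu_b)_\ge\beta\big)\Big](\nu_a)_\ge,$$ $$\Delta_b\Big[\bar\partial_{\bar n_a}\hat\beta+(\Delta_a\hat\beta)\big(\bar q_a+(\hat\nu_a)_\ge\hat\beta\big)\Big](\hat\nu_b)_\ge=\Delta_a\Big[\bar\partial_{\bar n_b}\hat\beta+(\Delta_b\hat\beta)\big(\bar q_b+(\hat\nu_b)_\ge\hat\beta\big)\Big](\hat\nu_a)_\ge.$$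
   Context: Let $D\ge1$, $z(\theta)=(e^{i\theta_1},\dots,e^{i\theta_D})$. For $\alpha\in\mathbb{Z}^D$ put $|\alpha|=\sum_a|\alpha_a|$, $z^\alpha=\prod_a z_a^{\alpha_a}$, $[k]=\{\alpha:|\alpha|=k\}$. Multi-indices are ordered by $|\alpha|$ and lexicographically inside each $[k]$; $\chi(z)$ is the semi-infinite column of all monomials in this order. Semi-infinite matrices have the corresponding block structure $A_{[k],[l]}$; $A^{[k]}$ denotes truncation to blocks $0,\dots,k-1$; $A_\ge$ denotes the block upper triangular part of $A$ (including block diagonal). $\mu$ is a complex Borel measure on $\mathbb{T}^D$. Parameters: complex times $t=(t_\alpha)_{\alpha\in\mathbb{Z}^D}$, finitely many nonzero, $t(z)=\sum t_\alpha z^\alpha$; integers $\mathbf m=(m_1,\dots,m_{2D})\in\mathbb{Z}_{\ge0}^{2D}$; fixed linearly independent vectors $n_a=(n_{a,-1},\dots,n_{a,-D},n_{a,D},\dots,n_{a,1})^\top\in\mathbb{C}^{2D}$ and fixed $q_a\in\mathbb{C}$, $a=1,\dots,2D$; $L_{n_a}(z)=\sum_{b=1}^D(n_{a,-b}z_b^{-1}+n_{a,b}z_b)$. $G(t,\mathbf m)=\oint\chi(z(\theta))\,e^{t(z(\theta))}\prod_a(L_{n_a}(z(\theta))-q_a)^{m_a}d\mu(\theta)\,\chi(z(\theta))^\dagger$. Quasi-definite means $\det G^{[k]}\ne0$ for all $k\ge1$; then uniquely $G=S^{-1}H(\hat S^{-1})^\dagger$, $S,\hat S$ block lower unitriangular,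 $H$ block diagonal. $\beta$ (resp. $\hat\beta$) is the first block subdiagonal of $S$ (resp. $\hat S$), i.e. the matrix with only nonzero blocks $S_{[k],[k-1]}$ (resp. $\hat S_{[k],[k-1]}$), $k\ge1$. $S$ is holomorphic in $t$, $\hat S$ is holomorphic in $\bar t$. $(\Upsilon_b)_{\beta,\gamma}=\delta_{\beta+e_b,\gamma}$, $\Upsilon_{-b}=\Upsilon_b^{-1}=\Upsilon_b^\top$ for $b\in\{1,\dots,D\}$; $\nu_a=\sum_{b=1}^D(n_{a,-b}\Upsilon_{-b}+n_{a,b}\Upsilon_b)$, $\hat\nu_a=\nu_a^\dagger=\sum_{b=1}^D(\overline{n_{a,-b}}\Upsilon_b+\overline{n_{a,b}}\Upsilon_{-b})$. With $t_{\pm b}$ denoting $t_\alpha$ for $\alpha=\pm e_b$: $\partial_{n_a}=\sum_{b\in\{\pm1,\dots,\pm D\}}n_{a,b}\,\partial/\partial t_b$ and $\bar\partial_{\bar n_a}=\sum_{b\in\{\pm1,\dots,\pm D\}}\overline{n_{a,b}}\,\partial/\partial\bar t_b$. $T_a$ is the shift $m_a\mapsto m_a+1$ and $\Delta_a=T_a-1$; in the equations $\Delta_b$ (resp. $\Delta_a$) acts on the bracket only (the matrices $\nu$ are constant). *)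

(* Defs.v *)
From HB Require Import structures.
From mathcomp Require Export all_boot all_order all_algebra.
From mathcomp Require Export all_classical all_reals all_analysis.
From mathcomp Require Export complex.
From mathcomp Require Import zify.

Set Implicit Arguments.
Unset Strict Implicit.
Unset Printing Implicit Defensive.

Import Order.TTheory GRing.Theory Num.Theory.
Import numFieldNormedType.Exports.

Local Open Scope classical_set_scope.
Local Open Scope ring_scope.

Section MultiIndices.
Context {D : nat}.

Definition midx := {ffun 'I_D -> int}.

Implicit Types al : midx.

Definition mlen al : nat := (\sum_(a < D) `|al a|%N)%N.

Definition unitidx (b : 'I_D) : midx := [ffun a => (a == b)%:Z].

Definition lexle al al' : bool :=
  (([seq al a | a <- enum 'I_D] : seqlexi int) <=
   ([seq al' a | a <- enum 'I_D] : seqlexi int))%O.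

(* The entries of a multi-index of length k lie in [-k, k], hence the shift
   of 'I_(2k+1). *)
Definition block (k : nat) : seq midx :=
  sort lexle
    [seq al <- [seq ([ffun a => (f a : nat)%:Z - k%:Z] : midx)
                 | f : {ffun 'I_D -> 'I_(k.*2.+1)}] | mlen al == k].

Definition blocks_lt (k : nat) : seq midx :=
  flatten [seq block l | l <- iota 0 k].

Lemma mem_block k al : (al \in block k) = (mlen al == k).
Proof.
rewrite mem_sort mem_filter andb_idr // => /eqP alk.
have bnd a : (absz (al a) <= k)%N.
  by rewrite -alk /mlen (bigD1 a) //= leq_addr.
have ge0 a : 0 <= al a + k%:Z by move: (bnd a); lia.
have lt2 a : (absz (al a + k%:Z)%R < k.*2.+1)%N by move: (bnd a); lia.
apply/mapP; exists [ffun a => Ordinal (lt2 a)]; first by rewrite mem_enum.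
by apply/ffunP => a; rewrite !ffunE /= gez0_abs // addrK.
Qed.

Lemma uniq_block k : uniq (block k).
Proof.
rewrite sort_uniq filter_uniq // map_inj_uniq ?enum_uniq // => f g /ffunP fg.
apply/ffunP => a; apply/val_inj; have := fg a.
by rewrite !ffunE => /addIr [].
Qed.

End MultiIndices.

Arguments midx : clear implicits.

(* Rows and columns are labelled by the multi-indices themselves; the order on
   multi-indices only enters through the truncations [trunc]. *)
Section SemiInfiniteMatrices.
Context {R : realType} {D : nat}.
Local Notation C := R[i].

Definition smx := midx D -> midx D -> C.

Implicit Types A B S H : smx.

(* The sum is over the support of the summand; it is finite in every product
   formed below. *)
Definition smul A B : smx :=
  fun al ga => \sum_(be \in [set: midx D]) (A al be * B be ga).

Definition sscalar (q : C) : smx := fun al be => if al == be then q else 0.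

Definition sadj A : smx := fun al be => (A be al)^*.

Definition upper A : smx :=
  fun al be => if (mlen al <= mlen be)%N then A al be else 0.

Definition subdiag A : smx :=
  fun al be => if mlen al == (mlen be).+1 then A al be else 0.

Definition trunc (k : nat) A : 'M[C]_(size (@blocks_lt D k)) :=
  \matrix_(i, j) A (tnth (in_tuple (blocks_lt k)) i)
                   (tnth (in_tuple (blocks_lt k)) j).

Definition quasi_definite A := forall k, (1 <= k)%N -> \det (trunc k A) != 0.

Definition block_diagonal A :=
  forall al be, mlen al <> mlen be -> A al be = 0.

Definition block_lower_unitriangular A :=
  (forall al be, (mlen al < mlen be)%N -> A al be = 0) /\
  (forall al be, mlen al = mlen be -> A al be = sscalar 1 al be).

Definition inverse_of A B := smul A B = sscalar 1 /\ smul B A = sscalar 1.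

Definition gauss_factorization G S H Sh :=
  [/\ block_lower_unitriangular S, block_lower_unitriangular Sh,
      block_diagonal H &
      exists Si Shi,
        [/\ block_lower_unitriangular Si, block_lower_unitriangular Shi,
            inverse_of S Si, inverse_of Sh Shi &
            G = smul (smul Si H) (sadj Shi)]].

Definition Upsilon (b : 'I_D) : smx :=
  fun be ga => if be + unitidx b == ga then 1 else 0.

Definition Upsilon_inv (b : 'I_D) : smx := fun be ga => Upsilon b ga be.

End SemiInfiniteMatrices.

Arguments smx : clear implicits.

(* Stated for any numFieldType so that the normed module structure of K over
   itself is found; it is used with K := R[i], where it is the complex
   derivative. *)
Definition cderive (K : numFieldType) (f : K -> K) (s : K) : K := derive1 f s.

Section ComplexIntegral.
Context {R : realType}.
Local Notation C := R[i].

Definition cexp (w : C) : C :=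
  (expR (complex.Re w))%:C%C
  * (cos (complex.Im w) +i* sin (complex.Im w))%C.

Section Measure.
Context {d : measure_display} {T : measurableType d}.

Record complex_measure := ComplexMeasure {
  cm_re : {charge set T -> \bar R};
  cm_im : {charge set T -> \bar R} }.

(* Integral against the Jordan decomposition of nu (which does not depend on
   the chosen Hahn decomposition). *)
Definition charge_integral (nu : {charge set T -> \bar R}) (X : set T)
    (f : T -> R) : R :=
  let P := projT1 (cid (Hahn_decomposition nu)) in
  let hP := projT2 (cid (Hahn_decomposition nu)) in
  let hN := projT2 (cid hP) in
  (\int[jordan_pos hN]_(x in X) f x)%R - (\int[jordan_neg hN]_(x in X) f x)%R.

Definition cintegral (mu : complex_measure) (X : set T) (f : T -> C) : C :=
  let u := fun x => complex.Re (f x) in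
  let v := fun x => complex.Im (f x) in
  ((charge_integral (cm_re mu) X u - charge_integral (cm_im mu) X v)
   +i* (charge_integral (cm_im mu) X u + charge_integral (cm_re mu) X v))%C.

End Measure.
End ComplexIntegral.

Arguments complex_measure R {d} T.

(* theta |-> z(theta) is a Borel isomorphism of [0, 2 pi)^D onto the torus, so
   complex Borel measures on the torus are carried by the angles. *)
Section Torus.
Context {R : realType} {D : nat}.
Local Notation C := R[i].

Definition angles := D.-tuple R.

Definition torus : set angles :=
  [set th | forall a, 0 <= tnth th a < pi *+ 2].

Definition zpt (th : angles) (a : 'I_D) : C := cexp (0 +i* tnth th a)%C.

Definition zmon (z : 'I_D -> C) (al : midx D) : C := \prod_a z a ^ al a.

Definition times := midx D -> C.

Definition finite_times (t : times) := finite_set [set al | t al != 0].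

Definition tpoly (t : times) (z : 'I_D -> C) : C :=
  \sum_(al \in [set: midx D]) (t al * zmon z al).

Definition tshift (t : times) (c : midx D) (s : C) : times :=
  fun al => if al == c then t al + s else t al.

Definition mexp := {ffun 'I_(D + D) -> nat}.

Definition mshift (m : mexp) (a : 'I_(D + D)) : mexp :=
  [ffun c => (m c + (c == a))%N].

(* Row a of n is (n_{a,-1}, .., n_{a,-D}, n_{a,D}, .., n_{a,1}). *)
Definition nneg (n : 'M[C]_(D + D)) (a : 'I_(D + D)) (b : 'I_D) : C :=
  n a (lshift D b).

Definition npos (n : 'M[C]_(D + D)) (a : 'I_(D + D)) (b : 'I_D) : C :=
  n a (rshift D (rev_ord b)).

Definition Lpoly (n : 'M[C]_(D + D)) a (z : 'I_D -> C) : C :=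
  \sum_(b < D) (nneg n a b * (z b)^-1 + npos n a b * z b).

Definition nu (n : 'M[C]_(D + D)) a : smx R D :=
  fun al be => \sum_(b < D) (nneg n a b * Upsilon_inv b al be
                             + npos n a b * Upsilon b al be).

Definition Gmx (mu : complex_measure R angles) (n : 'M[C]_(D + D))
    (q : 'I_(D + D) -> C) (t : times) (m : mexp) : smx R D :=
  fun al be => cintegral mu torus (fun th =>
    let z := zpt th in
    zmon z al * (cexp (tpoly t z) * \prod_a (Lpoly n a z - q a) ^+ m a)
    * (zmon z be)^*).

Definition pfun := times -> mexp -> smx R D.

Implicit Type F : pfun.

Definition pd (c : midx D) F : pfun :=
  fun t m al be => cderive (fun s : C => F (tshift t c s) m al be) 0.

(* Derivative in the conjugate time: for F holomorphic in the conjugates of the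
   times, [fun s => F (tshift t c s^* )] is holomorphic in s. *)
Definition pdbar (c : midx D) F : pfun :=
  fun t m al be => cderive (fun s : C => F (tshift t c s^*) m al be) 0.

Definition pdn (n : 'M[C]_(D + D)) a F : pfun := fun t m al be =>
  \sum_(b < D) (nneg n a b * pd (- unitidx b) F t m al be
                + npos n a b * pd (unitidx b) F t m al be).

Definition pdnbar (n : 'M[C]_(D + D)) a F : pfun := fun t m al be =>
  \sum_(b < D) ((nneg n a b)^* * pdbar (- unitidx b) F t m al be
                + (npos n a b)^* * pdbar (unitidx b) F t m al be).

Definition Delta a F : pfun := fun t m => F t (mshift m a) - F t m.

Definition bracket (n : 'M[C]_(D + D)) (q : 'I_(D + D) -> C) F a : pfun :=
  fun t m => pdn n a F t m
    + smul (Delta a F t m) (sscalar (q a) + smul (upper (nu n a)) (F t m)).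

Definition bracketbar (n : 'M[C]_(D + D)) (q : 'I_(D + D) -> C) F a : pfun :=
  fun t m => pdnbar n a F t m
    + smul (Delta a F t m)
        (sscalar (q a)^* + smul (upper (sadj (nu n a))) (F t m)).

(* Openness of a set of parameters in each of the complex times
   t_{+-e_1}, .., t_{+-e_D} with respect to which one differentiates. *)
Definition open_in_times (Om : times -> mexp -> Prop) :=
  forall t m, Om t m -> exists2 e : R, 0 < e &
    forall (b : 'I_D) (s : C), `|s| < e%:C%C ->
      Om (tshift t (unitidx b) s) m /\ Om (tshift t (- unitidx b) s) m.

End Torus.

Arguments angles : clear implicits.
Arguments times : clear implicits.
Arguments pfun : clear implicits.
Arguments mexp : clear implicits.

(* Main.v *)
(* Write N_+ for the block upper triangular part of nu_a, beta_2 for the second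
   block subdiagonal of S.  Multiplying the measure by L_a - q_a multiplies the
   Toeplitz moment matrix G by nu_a - q_a, and the time flow multiplies it by
   nu_a.  Since S G is block upper triangular, so is Y G for
     Y = (Delta_a S) nu_a - q_a T_a S - partial_a S,
   and Y itself is block lower triangular; quasi-definiteness then forces
   Y = Y_0 S with Y_0 the block diagonal of Y.  The first subdiagonal of this
   equation reads
     partial_a beta + (Delta_a beta)(q_a + N_+ beta) = (Delta_a beta_2) N_+,
   so both sides of the theorem equal (Delta_a Delta_b beta_2) N_a+ N_b+, because
   N_a+ and N_b+ commute.  The hatted equation is the same statement for the
   adjoint of G.  Holomorphy of S in the times comes from Cramer's rule and
   differentiation of the moments under the integral sign. *)
Require Import Defs.
From mathcomp Require Import measurable_realfun zify ring lra.

Set Implicit Arguments.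
Unset Strict Implicit.
Unset Printing Implicit Defensive.

Import Order.TTheory GRing.Theory Num.Theory.
Import numFieldNormedType.Exports.

Local Open Scope ring_scope.

(** * Block band matrices *)

Lemma blocks_ltS D k : blocks_lt k.+1 = blocks_lt k ++ @block D k.
Proof.
by rewrite /blocks_lt -addn1 iotaD map_cat flatten_cat /= cats0 add0n.
Qed.

Lemma mem_blocks_lt D k (al : midx D) : (al \in blocks_lt k) = (mlen al < k)%N.
Proof.
elim: k => [|k IH]; first by rewrite ltn0.
by rewrite blocks_ltS mem_cat IH mem_block ltnS [RHS]leq_eqVlt orbC.
Qed.

Lemma uniq_blocks_lt D k : uniq (@blocks_lt D k).
Proof.
elim: k => [//|k IH].
rewrite blocks_ltS cat_uniq IH uniq_block andbT; apply/hasPn => al.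
by rewrite mem_block mem_blocks_lt => /eqP ->; rewrite ltnn.
Qed.

Section BandMatrices.
Context {R : realType} {D : nat}.
Implicit Types (A B G S N : smx R D) (al be ga : midx D) (p k : nat).

(** Only the upper side is bounded. Since finitely many multi-indices have a given length, every row
    of [A] has finite support, and a product with [A] on the left is entrywise a finite sum. *)
Definition bandwidth p A :=
  forall al be, (mlen al + p < mlen be)%N -> A al be = 0.

Lemma smulE k A B al ga :
  (forall be, (k <= mlen be)%N -> A al be * B be ga = 0) ->
  smul A B al ga = \sum_(be <- blocks_lt k) A al be * B be ga.
Proof.
move=> AB0; rewrite /smul (fsbigE (blocks_lt k)) ?uniq_blocks_lt //.
  by apply: eq_bigl => be; rewrite in_setT.
by move=> be _; rewrite mem_blocks_lt -leqNgt; apply: AB0.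
Qed.

Lemma smul_bandE p k A B al ga : bandwidth p A -> (mlen al + p < k)%N ->
  smul A B al ga = \sum_(be <- blocks_lt k) A al be * B be ga.
Proof.
move=> bA alk; apply: smulE => be kbe.
by rewrite bA ?mul0r // (leq_trans alk).
Qed.

Lemma smxD A B al be : (A + B) al be = A al be + B al be.
Proof. by []. Qed.

Lemma smxB A B al be : (A - B) al be = A al be - B al be.
Proof. by []. Qed.

Lemma smulBl p A1 A2 B : bandwidth p A1 -> bandwidth p A2 ->
  smul (A1 - A2) B = smul A1 B - smul A2 B.
Proof.
move=> b1 b2; apply/funext => al; apply/funext => ga.
have b12 : bandwidth p (A1 - A2).
  by move=> x y xy; rewrite smxB b1 // b2 // subr0.
rewrite smxB (smul_bandE _ _ b12 (ltnSn _)) (smul_bandE _ _ b1 (ltnSn _)).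
rewrite (smul_bandE _ _ b2 (ltnSn _)) -sumrB.
by apply: eq_bigr => be _; rewrite smxB mulrBl.
Qed.

Lemma smulDr p A B1 B2 : bandwidth p A ->
  smul A (B1 + B2) = smul A B1 + smul A B2.
Proof.
move=> bA; apply/funext => al; apply/funext => ga.
rewrite smxD !(smul_bandE _ _ bA (ltnSn _)) -big_split /=.
by apply: eq_bigr => be _; rewrite smxD mulrDr.
Qed.

(** The rows of [A], of [B] and of [smul A B] are finitely supported. Once [k] exceeds
    [mlen al + p1 + p2], all the sums run over [blocks_lt k] and can be exchanged. *)
Lemma smulA p1 p2 A B (X : smx R D) : bandwidth p1 A -> bandwidth p2 B ->
  smul A (smul B X) = smul (smul A B) X.
Proof.
move=> bA bB; apply/funext => al; apply/funext => ga.
pose k := (mlen al + p1 + p2).+1.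
have bAB : bandwidth (p1 + p2) (smul A B).
  move=> x z xz; rewrite (smul_bandE _ _ bA (ltnSn _)) big_seq big1 // => y.
  rewrite mem_blocks_lt ltnS => yx; rewrite bB ?mulr0 //.
  by apply: leq_ltn_trans xz; rewrite addnA leq_add2r.
have alk : (mlen al + p1 < k)%N by rewrite ltnS leq_addr.
rewrite (smul_bandE _ _ bA alk) (smul_bandE (k := k) _ _ bAB) ?ltnS ?addnA //.
transitivity (\sum_(be <- blocks_lt k) \sum_(y <- blocks_lt k)
    A al be * B be y * X y ga); last first.
  rewrite exchange_big /=; apply: eq_bigr => y _.
  by rewrite -mulr_suml (smul_bandE _ _ bA alk).
apply: eq_bigr => be _; have [bea|bea] := leqP (mlen be) (mlen al + p1); last first.
  by rewrite bA // mul0r big1 // => y _; rewrite !mul0r.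
rewrite (smul_bandE (k := k) _ _ bB) ?ltnS ?leq_add2r // mulr_sumr.
by apply: eq_bigr => y _; rewrite mulrA.
Qed.

Lemma smul_sscalar p A q : bandwidth p A ->
  smul A (sscalar q) = fun al be => q * A al be.
Proof.
move=> bA; apply/funext => al; apply/funext => ga.
have [lt|le] := ltnP (mlen al + p) (mlen ga).
  rewrite bA // mulr0 (smul_bandE _ _ bA (ltnSn _)) big_seq big1 // => be.
  rewrite mem_blocks_lt ltnS /sscalar => le.
  have /negPf -> : be != ga by apply: contraTneq le => ->; rewrite -ltnNge.
  by rewrite mulr0.
rewrite (smul_bandE _ _ bA (ltnSn _)) (bigD1_seq ga) ?uniq_blocks_lt //=.
  rewrite /sscalar eqxx mulrC big1 ?addr0 // => be /negPf ->.
  by rewrite mulr0.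
by rewrite mem_blocks_lt ltnS.
Qed.

Lemma eq_smul A B A' B' al ga :
  (forall be, A al be * B be ga = A' al be * B' be ga) ->
  smul A B al ga = smul A' B' al ga.
Proof. by move=> e; rewrite /smul; apply: eq_fsbigr => be _. Qed.

Lemma smul_eq0 A B al ga :
  (forall be, A al be * B be ga = 0) -> smul A B al ga = 0.
Proof. by move=> e; rewrite /smul fsbig1. Qed.

(** * Toeplitz matrices, adjoints and quasi-definiteness *)

Definition toeplitz A := forall al be ga, A (al + ga) (be + ga) = A al be.

(** Commutativity of convolution on the lattice: the reflection [al + ga - de] of the summation
    index, followed by translations, exchanges the two factors. *)
Lemma toeplitz_comm A B : toeplitz A -> toeplitz B -> smul A B = smul B A.
Proof.
move=> tA tB; apply/funext => al; apply/funext => ga.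
have inv : involutive (fun de : midx D => al + ga - de).
  by move=> de; rewrite opprB addrCA subrr addr0.
rewrite /smul (reindex_fsbigT (fun de => al + ga - de)) /=; last first.
  exact: inv_bij.
apply: eq_fsbigr => de _; rewrite mulrC.
rewrite -(tB _ ga (de - ga)) -(tA al _ (de - al)).
by congr (B _ _ * A _ _); apply/ffunP => a; rewrite !ffunE; ring.
Qed.

Lemma smul_sadj p A B : bandwidth p A ->
  sadj (smul A B) = smul (sadj B) (sadj A).
Proof.
move=> bA; apply/funext => al; apply/funext => ga.
rewrite /sadj (smul_bandE _ _ bA (ltnSn _)) rmorph_sum /=.
rewrite (smulE (k := (mlen ga + p).+1)); last first.
  by move=> be lt; rewrite bA // conjC0 mulr0.
by apply: eq_bigr => be _; rewrite rmorphM mulrC.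
Qed.

(** The entries of [x] at lengths below [k] form a row vector in the left kernel of the invertible
    matrix [trunc k G]. *)
Lemma row_kernel0 G k (x : midx D -> R[i]) : quasi_definite G ->
  (forall ga, (mlen ga < k)%N ->
     \sum_(be <- blocks_lt k) x be * G be ga = 0) ->
  forall be, (mlen be < k)%N -> x be = 0.
Proof.
move=> qd xG be bek.
pose r := \row_i x (tnth (in_tuple (@blocks_lt D k)) i).
have rG : r *m trunc k G = 0.
  apply/rowP => j; rewrite !mxE -[RHS](xG (tnth (in_tuple (blocks_lt k)) j)).
    by rewrite [RHS]big_tnth; apply: eq_bigr => i _; rewrite !mxE.
  by rewrite -mem_blocks_lt mem_tnth.
(* Quasi-definiteness asks for [1 <= k]; this holds because [be] has length below [k]. *)
have Gu : trunc k G \in unitmx.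
  by rewrite unitmxE unitfE qd // (leq_ltn_trans _ bek).
have /tnthP[i ->] : be \in in_tuple (@blocks_lt D k) by rewrite mem_blocks_lt.
by move/(congr1 (mulmx^~ (invmx (trunc k G)))): rG => /=;
  rewrite mul0mx mulmxK // => /rowP /(_ i); rewrite !mxE.
Qed.

(** Row [al] of [S] holds the coefficients of a Laurent polynomial; the condition is its
    orthogonality to all monomials of smaller length, that is, [S G] is block upper triangular. *)
Definition orthogonal_below S G :=
  forall al ga, (mlen ga < mlen al)%N -> smul S G al ga = 0.

Lemma unitriangular_band S : block_lower_unitriangular S -> bandwidth 0 S.
Proof. by case=> S0 _ al be; rewrite addn0; apply: S0. Qed.

(* Subtracting from a row of [Y] the combination of rows of [S] with the same
   top block leaves a row of lower degree still orthogonal below, which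
   vanishes by quasi-definiteness. *)
Lemma orthogonal_below_expand G S Y : quasi_definite G ->
  block_lower_unitriangular S -> orthogonal_below S G ->
  bandwidth 0 Y -> orthogonal_below Y G ->
  forall al be, (mlen be < mlen al)%N ->
    Y al be = \sum_(ga <- block (mlen al)) Y al ga * S ga be.
Proof.
move=> qd Su SG bY YG al be beal; have bS := unitriangular_band Su.
pose x ga := Y al ga - \sum_(de <- block (mlen al)) Y al de * S de ga.
apply/eqP; rewrite -subr_eq0; apply/eqP; move: be beal.
apply: (row_kernel0 (x := x) qd) => ga gaal.
have x0 de : mlen de = mlen al -> x de = 0.
  move=> deal; rewrite /x (bigD1_seq de) ?uniq_block ?mem_block ?deal //=.
  rewrite (Su.2 de de) // /sscalar eqxx mulr1 big_seq_cond big1 ?addr0 ?subrr //.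
  move=> y /andP[]; rewrite mem_block => /eqP yal /negPf yde.
  by rewrite (Su.2 y de) ?yal // /sscalar yde mulr0.
transitivity (\sum_(be <- blocks_lt (mlen al).+1) x be * G be ga).
  rewrite blocks_ltS big_cat /= [X in _ + X]big_seq [X in _ + X]big1 ?addr0 //.
  by move=> de; rewrite mem_block => /eqP /x0 ->; rewrite mul0r.
have -> : \sum_(be <- blocks_lt (mlen al).+1) x be * G be ga =
    smul Y G al ga -
    \sum_(de <- block (mlen al)) Y al de * smul S G de ga.
  rewrite (smul_bandE (k := (mlen al).+1) _ _ bY) ?addn0 //.
  under [X in _ = _ - X]eq_big_seq => de.
    rewrite mem_block => /eqP deal.
    rewrite (smul_bandE (k := (mlen al).+1) _ _ bS) ?addn0 ?deal // mulr_sumr.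
    over.
  rewrite exchange_big -sumrB; apply: eq_bigr => be _.
  rewrite /x mulrBl mulr_suml; congr (_ - _).
  by apply: eq_bigr => de _; rewrite mulrA.
rewrite YG // big_seq big1 ?subr0 // => de; rewrite mem_block => /eqP deal.
by rewrite SG ?mulr0 ?deal.
Qed.

(** * Nearest-neighbour matrices and the first subdiagonal identity *)

Definition nearest_neighbour N := forall al be, N al be != 0 ->
  mlen be = (mlen al).+1 \/ mlen al = (mlen be).+1.

Definition subdiag2 A : smx R D :=
  fun al be => if mlen al == (mlen be).+2 then A al be else 0.

Lemma subdiag_band A : bandwidth 0 (subdiag A).
Proof. by move=> al be; rewrite addn0 /subdiag; case: eqP => // ->; lia. Qed.

Lemma subdiag2_band A : bandwidth 0 (subdiag2 A).
Proof. by move=> al be; rewrite addn0 /subdiag2; case: eqP => // ->; lia. Qed.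

Lemma bandwidthB p A B : bandwidth p A -> bandwidth p B -> bandwidth p (A - B).
Proof. by move=> bA bB al be lt; rewrite smxB bA // bB // subr0. Qed.

Lemma nearest_band N : nearest_neighbour N -> bandwidth 1 N.
Proof. by move=> NN al be lt; apply/eqP/negPn/negP => /NN; lia. Qed.

(** The block diagonal of [N] vanishes as well, so [upper N] is concentrated on the first block
    superdiagonal. *)
Lemma upper_neq0 N al be : nearest_neighbour N ->
  upper N al be != 0 -> mlen be = (mlen al).+1.
Proof.
by move=> NN; rewrite /upper; case: ifP => [le /NN|]; rewrite ?eqxx //; lia.
Qed.

Lemma upper_band N : nearest_neighbour N -> bandwidth 1 (upper N).
Proof.
by move=> NN al be lt; apply/eqP/negPn/negP => /(upper_neq0 NN); lia.
Qed.

(** A product of two steps can raise the length by two only if both steps go up. Hence the product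
    of the upper parts is the second superdiagonal of the full product, and it inherits
    commutation. *)
Lemma upper_comm M N : nearest_neighbour M -> nearest_neighbour N ->
  smul M N = smul N M ->
  smul (upper M) (upper N) = smul (upper N) (upper M).
Proof.
move=> nM nN MN; apply/funext => al; apply/funext => ga.
have up A B : nearest_neighbour A -> nearest_neighbour B ->
    smul (upper A) (upper B) al ga =
    if mlen ga == (mlen al).+2 then smul A B al ga else 0.
  move=> nA nB; case: eqP => gaal.
    apply: eq_smul => be.
    have [A0|/nA Ab] := eqVneq (A al be) 0.
      by rewrite /upper A0 mul0r; case: ifP; rewrite mul0r.
    have [B0|/nB Bb] := eqVneq (B be ga) 0.
      by rewrite /upper B0 mulr0; case: (mlen be <= _)%N; rewrite mulr0.
    by rewrite /upper !ifT //; lia.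
  apply: smul_eq0 => be; apply/eqP; rewrite mulf_eq0 -(negbK (_ || _)) negb_or.
  by apply/negP => /andP[/(upper_neq0 nA) ? /(upper_neq0 nB)]; lia.
by rewrite !up // MN.
Qed.

(* The matrix [Y = (S' - S) N - q S' - dS] is block lower triangular and
   orthogonal below, hence [Y = Y_0 S] with [Y_0] its block diagonal; the
   identity is the first subdiagonal of this equation. *)
Lemma bracket_identity G G' S S' N dS q : quasi_definite G ->
  nearest_neighbour N ->
  block_lower_unitriangular S -> block_lower_unitriangular S' ->
  orthogonal_below S G -> orthogonal_below S' G' ->
  (forall al be, G' al be = smul N G al be - q * G al be) ->
  (forall al be, (mlen al <= mlen be)%N -> dS al be = 0) ->
  (forall al ga, (mlen ga < mlen al)%N ->
     smul dS G al ga + smul S (smul N G) al ga = 0) ->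
  subdiag dS + smul (subdiag S' - subdiag S)
                 (sscalar q + smul (upper N) (subdiag S)) =
  smul (subdiag2 S' - subdiag2 S) (upper N).
Proof.
move=> qd nN uS uS' SG SG' GG' dS0 dSG.
have bS := unitriangular_band uS; have bS' := unitriangular_band uS'.
have bN := nearest_band nN; have bU := upper_band nN.
have bdS : bandwidth 0 dS by move=> al be lt; apply: dS0; lia.
have bD : bandwidth 0 (subdiag S' - subdiag S).
  by apply: bandwidthB; apply: subdiag_band.
have bE : bandwidth 0 (S' - S) by apply: bandwidthB.
have diff0 al be : (mlen al <= mlen be)%N -> (S' - S) al be = 0.
  rewrite leq_eqVlt smxB => /orP[/eqP e|lt].
    by rewrite (uS.2 _ _ e) (uS'.2 _ _ e) subrr.
  by rewrite (uS.1 _ _ lt) (uS'.1 _ _ lt) subrr.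
rewrite (smulDr _ _ bD) (smul_sscalar _ bD) (smulA _ bD bU).
apply/funext => al; apply/funext => be; rewrite smxD smxD; cbv beta.
have [albe|albe] := eqVneq (mlen al) (mlen be).+1; last first.

  (* Off the first subdiagonal every term of both sides vanishes: each factor changes the length by
     a fixed amount, and the total change is always from [mlen al] to [mlen al - 1]. *)
  rewrite {1}/subdiag (negPf albe) add0r smxB {1 2}/subdiag (negPf albe).
  rewrite subrr mulr0 add0r -(smulA _ bD bU) !smul_eq0 // => de.
    rewrite smxB /subdiag2; case: eqP => alde; last by rewrite subrr mul0r.
    apply/eqP; rewrite mulf_eq0; apply/orP; right.
    by apply/negPn/negP => /(upper_neq0 nN); lia.
  rewrite smxB /subdiag; case: eqP => alde; last by rewrite subrr mul0r.
  rewrite smul_eq0 ?mulr0 // => x; case: eqP => xbe; last by rewrite mulr0.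
  apply/eqP; rewrite mulf_eq0; apply/orP; left.
  by apply/negPn/negP => /(upper_neq0 nN); lia.
pose Y al be := smul (S' - S) N al be - q * S' al be - dS al be.
have bY : bandwidth 0 Y.
  move=> x y; rewrite addn0 => xy; rewrite /Y (uS'.1 _ _ xy) dS0 1?ltnW //.
  rewrite mulr0 !subr0 smul_eq0 // => z.
  have [zx|xz] := ltnP (mlen z) (mlen x); last by rewrite diff0 // mul0r.
  by rewrite bN ?mulr0 //; lia.
have YG : orthogonal_below Y G.
  move=> x z zx.
  have -> : smul Y G x z = smul (smul (S' - S) N) G x z - q * smul S' G x z
      - smul dS G x z.
    rewrite (smul_bandE (k := (mlen x).+2) _ _ bY) ?addn0 //.
    rewrite (smul_bandE (k := (mlen x).+2) _ _ bS') ?addn0 //.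
    rewrite (smul_bandE (k := (mlen x).+2) _ _ bdS) ?addn0 //.
    rewrite (@smulE (mlen x).+2 (smul _ _)); last first.
      move=> y xy; rewrite smul_eq0 ?mul0r // => w.
      have [wx|xw] := ltnP (mlen w) (mlen x); last by rewrite diff0 // mul0r.
      by rewrite bN ?mulr0 //; lia.
    rewrite mulr_sumr -!sumrB; apply: eq_bigr => y _.
    by rewrite !mulrBl mulrA.
  (* [Y G] is [S' (N G) - q S' G] minus [S (N G) + dS G]. The first part is [S' G']; both parts
     vanish below the block diagonal. *)
  rewrite -(smulA _ bE bN) (smulBl _ bS' bS) smxB.
  have := SG' _ _ zx; have -> : smul S' G' x z =
      smul S' (smul N G) x z - q * smul S' G x z.
    rewrite !(smul_bandE (k := (mlen x).+1) _ _ bS') ?addn0 // mulr_sumr -sumrB.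
    by apply: eq_bigr => y _; rewrite GG'; ring.
  by move: (dSG _ _ zx) => h1 h2; rewrite -[RHS]subr0 -{1}h2 -h1; ring.
have beal : (mlen be < mlen al)%N by rewrite albe.
have := orthogonal_below_expand qd uS SG bY YG beal.
(* Here [mlen be = mlen al - 1], so a nonzero [N de be] forces [de] to have length [mlen al - 2] or
   [mlen al]. The second case drops out because [S' - S] vanishes on the block diagonal. *)
have -> : smul (subdiag2 S' - subdiag2 S) (upper N) al be =
    smul (S' - S) N al be.
  apply: eq_smul => de.
  have [N0|/nN Nb] := eqVneq (N de be) 0.
    by rewrite /upper N0 if_same !mulr0.
  rewrite !smxB /subdiag2 /upper; case: eqP => alde.
    by rewrite ifT //; lia.
  by rewrite subrr mul0r -smxB diff0 ?mul0r //; lia.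
(* The factor [subdiag S] selects [ga] of length [mlen al]. The index between [S' - S] and [N] then
   has length [mlen al - 1], since [S' - S] kills length [mlen al + 1]; there [S' - S] is its own
   first subdiagonal. *)
have -> : smul (smul (subdiag S' - subdiag S) (upper N)) (subdiag S) al be =
    \sum_(ga <- block (mlen al)) smul (S' - S) N al ga * S ga be.
  rewrite (smulE (k := (mlen al).+1)); last first.
    by move=> x lt; rewrite /subdiag; case: eqP => e; rewrite ?mulr0 //; lia.
  rewrite blocks_ltS big_cat /= big_seq big1 ?add0r; last first.
    move=> x; rewrite mem_blocks_lt => lt.
    by rewrite /subdiag; case: eqP => e; rewrite ?mulr0 //; lia.
  apply: eq_big_seq => x; rewrite mem_block => /eqP xal.
  rewrite {3}/subdiag xal albe eqxx; congr (_ * _).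
  apply: eq_smul => de.
  have [N0|/nN Nb] := eqVneq (N de x) 0.
    by rewrite /upper N0 if_same !mulr0.
  rewrite !smxB /subdiag /upper; case: eqP => alde.
    by rewrite ifT //; lia.
  by rewrite subrr mul0r -smxB diff0 ?mul0r //; lia.
(* On the block diagonal [S'] is the identity and [dS] vanishes, so those two terms of [Y]
   contribute only the scalar [- q]. *)
have -> : \sum_(ga <- block (mlen al)) Y al ga * S ga be =
    \sum_(ga <- block (mlen al)) smul (S' - S) N al ga * S ga be -
    q * S al be.
  have -> : q * S al be =
      \sum_(ga <- block (mlen al)) q * sscalar 1 al ga * S ga be.
    rewrite (bigD1_seq al) ?uniq_block ?mem_block //= /sscalar eqxx mulr1.
    rewrite big1 ?addr0 // => x; rewrite eq_sym => /negPf ->.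
    by rewrite mulr0 mul0r.
  rewrite -sumrB; apply: eq_big_seq => x; rewrite mem_block => /eqP xal.
  by rewrite /Y dS0 ?xal // (uS'.2 _ _ (esym xal)) subr0 mulrBl.
rewrite smxB /Y /subdiag albe !eqxx => /(canRL (subrK _)) /(canRL (subrK _)) ->.
ring.
Qed.

End BandMatrices.

(** * Complex derivatives *)

Section ComplexDerivative.
Context {K : numFieldType}.
Implicit Types (f g : K -> K) (x : K).

Definition cderivable f x : Prop := derivable f x 1.

Lemma cderivable_cst c x : cderivable (fun=> c) x.
Proof. exact: derivable_cst. Qed.

Lemma cderivableD f g x :
  cderivable f x -> cderivable g x -> cderivable (fun s => f s + g s) x.
Proof. exact: derivableD. Qed.

Lemma cderivableM f g x :
  cderivable f x -> cderivable g x -> cderivable (fun s => f s * g s) x.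
Proof. exact: derivableM. Qed.

Lemma near0_ball (e : K) (P : K -> Prop) : 0 < e ->
  (forall s, `|s| < e -> P s) -> \forall s \near (0 : K), P s.
Proof.
move=> e0 eP; apply/nbhs_ballP; exists e => //= s.
by rewrite -ball_normE /= sub0r normrN => /eP.
Qed.

Lemma cderivable_sum (I : Type) (r : seq I) (F : I -> K -> K) x :
  (forall i, cderivable (F i) x) ->
  cderivable (fun s => \sum_(i <- r) F i s) x.
Proof.
move=> dF; elim: r => [|i r IH].
  by under eq_fun do rewrite big_nil; apply: cderivable_cst.
by under eq_fun do rewrite big_cons; apply: cderivableD.
Qed.

Lemma cderivable_prod (I : Type) (r : seq I) (F : I -> K -> K) x :
  (forall i, cderivable (F i) x) ->
  cderivable (fun s => \prod_(i <- r) F i s) x.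
Proof.
move=> dF; elim: r => [|i r IH].
  by under eq_fun do rewrite big_nil; apply: cderivable_cst.
by under eq_fun do rewrite big_cons; apply: cderivableM.
Qed.

Lemma cderivable_det n (A : K -> 'M[K]_n) x :
  (forall i j, cderivable (fun s => A s i j) x) ->
  cderivable (fun s => \det (A s)) x.
Proof.
move=> dA; rewrite /determinant; apply: cderivable_sum => p.
apply: cderivableM; first exact: cderivable_cst.
exact: cderivable_prod.
Qed.

Lemma cderivable_adj n (A : K -> 'M[K]_n) x i j :
  (forall i j, cderivable (fun s => A s i j) x) ->
  cderivable (fun s => (\adj (A s)) i j) x.
Proof.
move=> dA; under eq_fun do rewrite mxE /cofactor.
apply: cderivableM; first exact: cderivable_cst.
apply: cderivable_det => k l.
by under eq_fun do rewrite !mxE; apply: dA.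
Qed.

(** Cramer's rule: near 0 the solution [u] coincides with [v] times the adjugate over the
    determinant, an expression built from derivable functions. *)
Lemma cderivable_linear_solution n (A : K -> 'M[K]_n) (u v : K -> 'rV[K]_n) j :
  (forall i j, cderivable (fun s => A s i j) 0) ->
  (forall j, cderivable (fun s => v s 0 j) 0) ->
  (exists2 e, 0 < e & forall s, `|s| < e ->
     \det (A s) != 0 /\ u s *m A s = v s) ->
  cderivable (fun s => u s 0 j) 0.
Proof.
move=> dA dv [e e0 eA]; have nA := near0_ball e0 eA.
pose w s := \sum_k v s 0 k * ((\det (A s))^-1 * (\adj (A s)) k j).
apply: (@near_eq_derivable _ _ _ w).
  near=> s; rewrite /w.
  have [dets <-] : \det (A s) != 0 /\ u s *m A s = v s by near: s.
  have uA : A s \in unitmx by rewrite unitmxE unitfE.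
  rewrite -[u s in RHS](mulmxK uA) [in RHS]mxE; apply: eq_bigr => k _.
  by rewrite /invmx uA !mxE.
apply: cderivable_sum => k; apply: cderivableM => //.
apply: cderivableM; last exact: cderivable_adj.
apply: derivableV; last exact: cderivable_det.
by have [] := nbhs_singleton nA.
Unshelve. all: by end_near. Qed.

(** The product rule for a finite sum of products that vanishes identically near 0; it serves to
    differentiate the orthogonality relations. *)
Lemma cderive_sum0 (I : Type) (r : seq I) (f g : I -> K -> K) :
  (forall i, cderivable (f i) 0) -> (forall i, cderivable (g i) 0) ->
  (exists2 e, 0 < e & forall s, `|s| < e -> \sum_(i <- r) f i s * g i s = 0) ->
  \sum_(i <- r) (cderive (f i) 0 * g i 0 + f i 0 * cderive (g i) 0) = 0.
Proof.
move=> df dg [e e0 /(near0_ball e0) fg0].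
transitivity ('D_1 (fun s => \sum_(i <- r) f i s * g i s   : K) 0); last first.
  by rewrite (@near_eq_derive _ _ _ _ (cst 0)) ?derive_cst.
elim: r {fg0} => [|i r IH].
  by rewrite big_nil; under eq_fun do rewrite big_nil; rewrite derive_cst.
under [in RHS]eq_fun do rewrite big_cons.
have dsum : cderivable (fun s => \sum_(j <- r) f j s * g j s) 0.
  by apply: cderivable_sum => k; apply: cderivableM.
rewrite (deriveD (derivableM (df i) (dg i)) dsum) -IH (deriveM (df i) (dg i)).
rewrite big_cons /cderive !derive1E; congr (_ + _).
by rewrite addrC [_ *: 'D_1 (f i) 0]mulrC.
Qed.

Lemma cderive_eq0 f g : (exists2 e, 0 < e & forall s, `|s| < e -> f s = g s) ->
  cderivable f 0 -> cderivable g 0 /\ cderive g 0 = cderive f 0.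
Proof.
move=> [e e0 /(near0_ball e0) fg] df; split; first exact: near_eq_derivable df.
by rewrite /cderive !derive1E; apply/esym/near_eq_derive.
Qed.

Lemma cderive_const c x : cderivable (fun=> c) x /\ cderive (fun=> c) x = 0.
Proof.
by split; [exact: cderivable_cst|rewrite /cderive derive1E derive_cst].
Qed.

Lemma cderivable_opp f x : cderivable f x -> cderivable (fun s => - f s) x.
Proof. exact: derivableN. Qed.

(** Dividing the remainder by [s] puts the difference quotient within [M * |s|] of [l]. The moments
    are estimated in this form. *)
Lemma cderive_quadratic f l (M d : K) : 0 <= M -> 0 < d ->
  (forall s, `|s| < d -> `|f s - f 0 - s * l| <= M * `|s| ^+ 2) ->
  cderivable f 0 /\ cderive f 0 = l.
Proof.
move=> M0 d0 fq.
have h : ((fun h : K => h^-1 *: ((f \o shift 0) (h *: (1 : K)) - f 0))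
    @ 0^' --> l)%classic.
  apply/cvgrPdist_le => /= e e0.
  near=> s.
  have s0 : s != 0 by near: s; exact: nbhs_dnbhs_neq.
  have sd : `|s| < d.
    by near: s; apply: dnbhs0_lt.
  (* The denominator [M + 1] stays positive when [M] is 0. *)
  have se : `|s| < e / (M + 1).
    by near: s; apply: dnbhs0_lt; rewrite divr_gt0 // ltr_wpDl.
  rewrite /= [s *: 1]mulr1 addr0 distrC.
  have -> : s^-1 *: (f s - f 0) - l = s^-1 * (f s - f 0 - s * l).
    by rewrite mulrBr mulKf.
  rewrite normrM normfV ler_pdivrMl ?normr_gt0 // (le_trans (fq _ sd)) //.
  rewrite expr2 mulrCA ler_wpM2l //.
  move: se; rewrite ltr_pdivlMr ?ltr_wpDl // => /ltW; apply: le_trans.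
  by rewrite mulrC ler_wpM2l // lerDl.
split; first by apply/cvg_ex; exists l.
by rewrite /cderive derive1E; apply: cvg_lim.
Unshelve. all: by end_near. Qed.

End ComplexDerivative.

(** * Evolution of the triangular factor *)

Section Evolution.
Context {R : realType} {D : nat}.
Local Notation C := R[i].
Implicit Types (G S dG dS : smx R D) (Gs Ss : C -> smx R D) (al be ga : midx D).

(** The linearization of [orthogonal_below]: the first-order variation of [S G] vanishes below the
    block diagonal. *)
Definition flow_orthogonal S G dS dG := forall al ga, (mlen ga < mlen al)%N ->
  smul dS G al ga + smul S dG al ga = 0.

Definition factor_near0 Gs Ss := exists2 e : C, 0 < e & forall s, `|s| < e ->
  [/\ quasi_definite (Gs s), block_lower_unitriangular (Ss s) &
      orthogonal_below (Ss s) (Gs s)].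

(** In the orthogonality relation the identity diagonal block contributes only [G al ga]. The
    remaining entries of row [al] thus solve a square linear system with matrix
    [trunc (mlen al) G]. *)
Lemma orthogonal_below_row S G al ga : block_lower_unitriangular S ->
  orthogonal_below S G -> (mlen ga < mlen al)%N ->
  \sum_(be <- blocks_lt (mlen al)) S al be * G be ga = - G al ga.
Proof.
move=> uS SG lt; apply/eqP; rewrite -subr_eq0 opprK -[X in _ == X](SG _ _ lt).
rewrite (smul_bandE (k := (mlen al).+1) _ _ (unitriangular_band uS)) ?addn0 //.
rewrite blocks_ltS big_cat /=; apply/eqP; congr (_ + _).
rewrite (bigD1_seq al) ?uniq_block ?mem_block //= (uS.2 al al) // /sscalar eqxx.
rewrite mul1r big_seq_cond big1 ?addr0 // => be /andP[].
rewrite mem_block => /eqP beal; rewrite eq_sym => /negPf ne.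
by rewrite (uS.2 _ _ (esym beal)) /sscalar ne mul0r.
Qed.

Lemma factor_lower Gs Ss al be : factor_near0 Gs Ss ->
  (mlen al <= mlen be)%N ->
  cderivable (fun s : C => Ss s al be) 0 /\ cderive (fun s : C => Ss s al be) 0 = 0.
Proof.
move=> [e e0 fac] le.
have [c0 dc0] := cderive_const (sscalar (D := D) 1 al be : C) 0.
suff eS : exists2 d : C, 0 < d &
    forall s, `|s| < d -> (sscalar 1 al be : C) = Ss s al be.
  by have [dS ->] := cderive_eq0 eS c0.
exists e => // s /fac[_ [S0 S1] _].
move: le; rewrite leq_eqVlt => /orP[/eqP|lt]; first by move=> /S1 ->.
by rewrite S0 // /sscalar; case: eqP lt => // ->; rewrite ltnn.
Qed.

(** On and above the block diagonal the entries are constant near 0. Below it, row [al] solves the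
    linear system of [orthogonal_below_row], whose determinant is nonzero by quasi-definiteness. *)
Lemma factor_cderivable Gs Ss :
  (forall al be, cderivable (fun s : C => Gs s al be) 0) -> factor_near0 Gs Ss ->
  forall al be, cderivable (fun s : C => Ss s al be) 0.
Proof.
move=> dG fac al be; have [le|lt] := leqP (mlen al) (mlen be).
  by have [] := factor_lower fac le.
have /tnthP[j ->] : be \in in_tuple (@blocks_lt D (mlen al)).
  by rewrite mem_blocks_lt.
set l := in_tuple (@blocks_lt D (mlen al)) in j *.
have -> : (fun s : C => Ss s al (tnth l j)) =
    (fun s => (\row_i Ss s al (tnth l i)) 0 j).
  by apply/funext => s; rewrite mxE.
apply: (cderivable_linear_solution (A := fun s => trunc (mlen al) (Gs s))
  (v := fun s => \row_i - Gs s al (tnth l i))) => [i k|k|].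
- by under eq_fun do rewrite mxE; apply: dG.
- by under eq_fun do rewrite mxE; apply: cderivable_opp; apply: dG.
case: fac => e e0 fac; exists e => // s /fac[qd uS SG]; split.
by apply: qd; apply: leq_ltn_trans lt.
apply/rowP => k; rewrite !mxE -(orthogonal_below_row uS SG); last first.
  by rewrite -mem_blocks_lt mem_tnth.
by rewrite [RHS]big_tnth; apply: eq_bigr => i _; rewrite !mxE.
Qed.

Lemma factor_flow Gs Ss :
  (forall al be, cderivable (fun s : C => Gs s al be) 0) -> factor_near0 Gs Ss ->
  flow_orthogonal (Ss 0) (Gs 0) (fun al be => cderive (fun s : C => Ss s al be) 0)
                  (fun al be => cderive (fun s : C => Gs s al be) 0).
Proof.
move=> dG fac al ga lt; have dS := factor_cderivable dG fac.
have bd : bandwidth 0 (fun al be => cderive (fun s : C => Ss s al be) 0).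
  by move=> x y; rewrite addn0 => /ltnW /(factor_lower fac)[].
have b0 : bandwidth 0 (Ss 0).
  case: fac => e e0 /(_ 0); rewrite normr0 => /(_ e0)[_ + _].
  exact: unitriangular_band.
rewrite (smul_bandE (k := (mlen al).+1) _ _ bd) ?addn0 //.
rewrite (smul_bandE (k := (mlen al).+1) _ _ b0) ?addn0 // -big_split /=.
apply: (cderive_sum0 (f := fun be s => Ss s al be)
  (g := fun be s => Gs s be ga)) => //.
case: fac => e e0 fac; exists e => // s /fac[_ uS SG].
rewrite -[RHS](SG _ _ lt).
by rewrite (smul_bandE (k := (mlen al).+1) _ _ (unitriangular_band uS)) ?addn0.
Qed.

(** Passes from the flows in single times to the directional flow with coefficients [c]. *)
Lemma flow_orthogonal_comb (I : finType) S G (c : I -> C)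
    (dS dG : I -> smx R D) :
  bandwidth 0 S -> (forall i, bandwidth 0 (dS i)) ->
  (forall i, flow_orthogonal S G (dS i) (dG i)) ->
  flow_orthogonal S G (fun al be => \sum_i c i * dS i al be)
                      (fun al be => \sum_i c i * dG i al be).
Proof.
move=> bS bdS flow al ga lt.
have bd : bandwidth 0 (fun al be => \sum_i c i * dS i al be).
  by move=> x y xy; rewrite big1 // => i _; rewrite bdS // mulr0.
transitivity (\sum_i c i * (smul (dS i) G al ga + smul S (dG i) al ga)).
  under eq_bigr do rewrite mulrDr; rewrite big_split /=; congr (_ + _).
    rewrite (smul_bandE (k := (mlen al).+1) _ _ bd) ?addn0 //.
    under [RHS]eq_bigr => i _.
      rewrite (smul_bandE (k := (mlen al).+1) _ _ (bdS i)) ?addn0 // mulr_sumr.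
      over.
    rewrite exchange_big /=; apply: eq_bigr => be _.
    by rewrite mulr_suml; apply: eq_bigr => i _; rewrite mulrA.
  rewrite (smul_bandE (k := (mlen al).+1) _ _ bS) ?addn0 //.
  under [RHS]eq_bigr => i _.
    rewrite (smul_bandE (k := (mlen al).+1) _ _ bS) ?addn0 // mulr_sumr.
    over.
  rewrite exchange_big /=; apply: eq_bigr => be _.
  by rewrite mulr_sumr; apply: eq_bigr => i _; rewrite mulrCA.
by rewrite big1 // => i _; rewrite flow ?mulr0.
Qed.

(** Cancelling [S] against its inverse leaves [S G = H (sadj Shi)], a block diagonal times an upper
    triangular matrix. Taking adjoints first gives [Sh (sadj G) = (sadj H) (sadj Si)] in the same
    way. *)
Lemma gauss_orthogonal G S H Sh : gauss_factorization G S H Sh ->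
  orthogonal_below S G /\ orthogonal_below Sh (sadj G).
Proof.
case=> uS uSh dH [Si [Shi [uSi uShi [SSi _] [ShShi _] ->]]].
have [bS bSh] := (unitriangular_band uS, unitriangular_band uSh).
have [bSi bShi] := (unitriangular_band uSi, unitriangular_band uShi).
have bH : bandwidth 0 H by move=> x y xy; apply: dH; lia.
have one_smul A : smul (sscalar 1) A = A.
  apply/funext => al; apply/funext => ga; rewrite (smulE (k := (mlen al).+1)).
    rewrite (bigD1_seq al) ?uniq_blocks_lt ?mem_blocks_lt //= /sscalar eqxx.
    rewrite mul1r big1 ?addr0 // => y; rewrite eq_sym => /negPf ->.
    by rewrite mul0r.
  move=> be lt; rewrite /sscalar; case: eqP lt => [->|_]; last by rewrite mul0r.
  by rewrite ltnn.
have tri A B x y : block_diagonal A -> block_lower_unitriangular B ->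
    (mlen y < mlen x)%N -> smul A (sadj B) x y = 0.
  move=> dA uB lt; apply: smul_eq0 => z.
  have [xz|/eqP xz] := eqVneq (mlen x) (mlen z); last by rewrite dA ?mul0r.
  by rewrite /sadj (uB.1 y z) ?conjC0 ?mulr0 // -xz.
have dHa : block_diagonal (sadj H).
  by move=> x y /eqP; rewrite eq_sym => /eqP xy; rewrite /sadj dH ?conjC0.
have bSiH : bandwidth 0 (smul Si H).
  move=> x y xy; apply: smul_eq0 => z.
  have [le|lt'] := leqP (mlen z) (mlen x); last by rewrite bSi ?mul0r // addn0.
  by rewrite bH ?mulr0 // addn0; apply: leq_ltn_trans le _; rewrite addn0 in xy.
split=> al ga lt.
  by rewrite (smulA _ bS bSiH) (smulA _ bS bSi) SSi one_smul tri.
have sadjK A : sadj (sadj A) = A.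
  by apply/funext => x; apply/funext => y; rewrite /sadj conjCK.
rewrite (smul_sadj _ bSiH) sadjK (smul_sadj _ bSi) (smulA _ bSh bShi) ShShi.
by rewrite one_smul tri.
Qed.

Lemma sadj_nearest (N : smx R D) :
  nearest_neighbour N -> nearest_neighbour (sadj N).
Proof. by move=> nN al be; rewrite /sadj conjC_eq0 => /nN[]; [right|left]. Qed.

Lemma quasi_definite_sadj G : quasi_definite G -> quasi_definite (sadj G).
Proof.
move=> qd k k1.
have -> : trunc k (sadj G) = (map_mx Num.conj (trunc k G))^T.
  by apply/matrixP => i j; rewrite !mxE.
by rewrite det_tr det_map_mx fmorph_eq0 qd.
Qed.

(** A form common to both equations: [Gs i] and [Ss i] are the matrices along the flow of one time,
    and the combination of these flows with coefficients [c] multiplies [G] by [N] on the left, as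
    the discrete shift does up to [q]. *)
Lemma bracket_of_flow (I : finType) (c : I -> C) (Gs Ss : I -> C -> smx R D)
    (dG : I -> smx R D) G G' S S' (N : smx R D) q :
  nearest_neighbour N -> quasi_definite G ->
  block_lower_unitriangular S -> block_lower_unitriangular S' ->
  orthogonal_below S G -> orthogonal_below S' G' ->
  (forall al be, G' al be = smul N G al be - q * G al be) ->
  (forall i, Gs i 0 = G) -> (forall i, Ss i 0 = S) ->
  (forall i, factor_near0 (Gs i) (Ss i)) ->
  (forall i al be, cderivable (fun s : C => Gs i s al be) 0 /\
     cderive (fun s : C => Gs i s al be) 0 = dG i al be) ->
  (forall al be, smul N G al be = \sum_i c i * dG i al be) ->
  (fun al be => \sum_i c i * cderive (fun s : C => subdiag (Ss i s) al be) 0) +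
    smul (subdiag S' - subdiag S) (sscalar q + smul (upper N) (subdiag S)) =
  smul (subdiag2 S' - subdiag2 S) (upper N).
Proof.
move=> nN qd uS uS' SG SG' GG' Gs0 Ss0 fac dGs NG.
pose dSi i al be := cderive (fun s : C => Ss i s al be) 0.
pose dS al be := \sum_i c i * dSi i al be.
have lower i al be : (mlen al <= mlen be)%N -> dSi i al be = 0.
  by move=> /(factor_lower (fac i))[].
have -> : (fun al be => \sum_i c i *
    cderive (fun s : C => subdiag (Ss i s) al be) 0) = subdiag dS.
  apply/funext => al; apply/funext => be; rewrite /subdiag.
  case: eqP => _; first by [].
  by rewrite big1 // => i _; rewrite (cderive_const (0 : C) 0).2 mulr0.
apply: (bracket_identity qd nN uS uS' SG SG' GG') => [al be le|].
  by rewrite /dS big1 // => i _; rewrite lower ?mulr0.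
have flow : flow_orthogonal S G dS (fun al be => \sum_i c i * dG i al be).
  apply: flow_orthogonal_comb => [|i|i]; first exact: unitriangular_band.
    by move=> x y; rewrite addn0 => /ltnW; apply: lower.
  have := factor_flow (fun al be => (dGs i al be).1) (fac i).
  rewrite Gs0 Ss0; congr flow_orthogonal.
  by apply/funext => al; apply/funext => be; rewrite (dGs i al be).2.
have -> : smul N G = fun al be => \sum_i c i * dG i al be.
  by apply/funext => x; apply/funext => y; rewrite NG.
exact: flow.
Qed.

End Evolution.

(** * The complex exponential *)

Section ComplexExponential.
Context {R : realType}.
Implicit Types (x y : R) (u w z : R[i]).

Lemma norm_ReIm_le z : `|z| <= (`|complex.Re z| + `|complex.Im z|)%:C%C.
Proof.
rewrite normc_def lecR -[leRHS]ger0_norm ?addr_ge0 // -sqrtr_sqr ler_wsqrtr //.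
rewrite sqrrD !real_normK ?num_real // -addrA lerD2l lerDr.
by rewrite mulrn_wge0 // mulr_ge0.
Qed.

Lemma Re_le_norm z : (`|complex.Re z|)%:C%C <= `|z|.
Proof.
rewrite normc_def lecR -sqrtr_sqr ler_wsqrtr // lerDl sqr_ge0 //.
Qed.

Lemma Im_le_norm z : (`|complex.Im z|)%:C%C <= `|z|.
Proof.
rewrite normc_def lecR -sqrtr_sqr ler_wsqrtr // lerDr sqr_ge0 //.
Qed.

Lemma sin_MVT y : 0 <= y -> exists2 c, 0 <= c <= y & sin y = cos c * y.
Proof.
move=> y0; have csin : {within `[0, y]%classic, continuous (@sin R)}%classic.
  by apply: continuous_subspaceT => x; apply: continuous_sin.
have [c cin] := MVT_segment y0 (fun x _ => is_derive_sin x) csin.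
by rewrite sin0 !subr0 => e; exists c; rewrite ?in_itv in cin *.
Qed.

Lemma normr_sin_le y : `|sin y| <= `|y|.
Proof.
wlog y0 : y / 0 <= y.
  move=> h; have [/h//|y0] := leP 0 y.
  by rewrite -normrN -sinN -[leRHS]normrN h // oppr_ge0 ltW.
have [c _ ->] := sin_MVT y0; rewrite normrM ler_piMl //; exact: cos_max.
Qed.

(** By the half-angle formula, [1 - cos y] is twice the square of [sin (y / 2)]. *)
Lemma cos_sub1_le y : `|cos y - 1| <= y ^+ 2.
Proof.
have ec : cos y = cos (y / 2) ^+ 2 *+ 2 - 1.
  by rewrite -cos_mulr2n -(mulr_natr (y / 2)) divfK.
have := normr_sin_le (y / 2); rewrite -ler_sqr ?nnegrE // !real_normK ?num_real //.
have := cos2Dsin2 (y / 2); rewrite ec distrC.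
by move: (cos _) (sin _) => c s cs1 sy; rewrite ger0_norm; nra.
Qed.

(** For [y >= 0] the mean value theorem gives [sin y - y = (cos c - 1) * y] with [0 <= c <= y], and
    the first factor is at most [c ^+ 2 <= y] in absolute value. *)
Lemma sin_sub_le y : `|y| <= 1 -> `|sin y - y| <= y ^+ 2.
Proof.
wlog y0 : y / 0 <= y.
  move=> h; have [/h//|y0] := leP 0 y; move=> y1.
  have := h (- y); rewrite oppr_ge0 ltW // normrN sinN sqrrN => /(_ isT y1).
  by rewrite -opprD normrN.
rewrite ger0_norm // => y1; have [c /andP[c0 cy] ->] := sin_MVT y0.
rewrite -[X in _ - X]mul1r -mulrBl normrM (ger0_norm y0) expr2 ler_wpM2r //.
by apply: le_trans (cos_sub1_le c) _; nra.
Qed.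

(** The bound [1 + x <= expR x] at [- x] gives [expR x <= 1 / (1 - x)], and [1 / (1 - x) - 1 - x]
    equals [x ^+ 2 / (1 - x)], with [1 - x] at least one half. *)
Lemma expR_sub_le x : `|x| <= 2^-1 -> 0 <= expR x - 1 - x <= 2 * x ^+ 2.
Proof.
rewrite ler_norml => /andP[x1 x2]; have := expR_ge1Dx x; have := expR_ge1Dx (- x).
have := expRxMexpNx_1 x; have := expR_gt0 x.
move: (expR x) (expR (- x)) => a b a0 ab b1 a1; apply/andP; split; first lra.
have ax : a * (1 - x) <= 1 by rewrite -[leRHS]ab ler_wpM2l // ltW.
have x0 : 0 < 1 - x by lra.
rewrite -(ler_pM2r x0); have := mulr_ge0 (sqr_ge0 x) (ltW x0).
have := mulr_ge0 (sqr_ge0 x) (_ : 0 <= 2^-1 - x).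
by rewrite subr_ge0 => /(_ x2); nra.
Qed.

Lemma cexpD u w : cexp (u + w) = cexp u * cexp w.
Proof.
case: u => a b; case: w => c d; rewrite /cexp /= expRD cosD sinD.
by apply/eqP; rewrite eq_complex /=; apply/andP; split; apply/eqP; ring.
Qed.

(** With [u = x + i y], the real and imaginary parts of the remainder are bounded separately by [h1]
    and [h2]; the bounds add up to [5 x^2 + (7/2) y^2], whence the constant 5. *)
Lemma cexp_sub_le u : `|u| <= (2^-1)%:C%C ->
  `|cexp u - 1 - u| <= 5 * `|u| ^+ 2.
Proof.
move=> u2.
have := le_trans (Re_le_norm u) u2; have := le_trans (Im_le_norm u) u2.
rewrite -add_Re2_Im2 !lecR; case: u {u2} => x y /= y2 x2.
apply: le_trans (norm_ReIm_le _) _.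
have -> : 5 = (5 : R)%:C%C by rewrite rmorph_nat.
rewrite -rmorphM lecR /=.
have y1 : `|y| <= 1 by lra.
have := expR_sub_le x2; have := cos_sub1_le y; have := sin_sub_le y1.
have := normr_sin_le y; have := cos_max y.
rewrite !(mul0r, oppr0, addr0, subr0, add0r).
move: (expR x) (cos y) (sin y) => a c s c1 sy ss cc /andP[a0 a1].
have h1 : `|a * c - 1 - x| <= 2 * x ^+ 2 + 3/2 * y ^+ 2.
  have -> : a * c - 1 - x = (a - 1 - x) * c + (1 + x) * (c - 1) by ring.
  apply: le_trans (ler_normD _ _) _; rewrite !normrM; apply: lerD.
    by rewrite (ger0_norm a0) -[leRHS]mulr1 ler_pM.
  apply: ler_pM => //.
  by move: x2; rewrite !ler_norml => /andP[? ?]; apply/andP; split; lra.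
have h2 : `|a * s - y| <= 2 * x ^+ 2 + (x ^+ 2 + y ^+ 2) + y ^+ 2.
  have -> : a * s - y = (a - 1 - x) * s + x * s + (s - y) by ring.
  apply: le_trans (ler_normD _ _) _; apply: lerD => //.
  apply: le_trans (ler_normD _ _) _; rewrite !normrM; apply: lerD.
    rewrite (ger0_norm a0) -[leRHS]mulr1 ler_pM //; lra.
  apply: le_trans (_ : `|x| * `|y| <= _); first by rewrite ler_wpM2l.
  rewrite -(real_normK (num_real x)) -(real_normK (num_real y)).
  have := sqr_ge0 (`|x| - `|y|); move: (normr_ge0 x) (normr_ge0 y); nra.
have := sqr_ge0 x; have := sqr_ge0 y; lra.
Qed.

End ComplexExponential.

(** * Integration against complex measures *)

Section BoundedIntegrands.
Context {R : realType} {d : measure_display} {T : measurableType d}.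
Implicit Types (f g : T -> R[i]) (X : set T).

(** A class closed under the operations that build the integrands and integrable against every
    finite measure, so that linearity of the integral applies throughout. *)
Definition bounded_measurable f :=
  [/\ measurable_fun setT (fun x => complex.Re (f x)),
      measurable_fun setT (fun x => complex.Im (f x)) &
      exists M : R, forall x, `|f x| <= M%:C%C].

Lemma bounded_measurable_cst c : bounded_measurable (fun=> c).
Proof.
split; [exact: measurable_cst|exact: measurable_cst|].
by exists (`|complex.Re c| + `|complex.Im c|) => x; apply: norm_ReIm_le.
Qed.

Lemma bounded_measurableD f g : bounded_measurable f -> bounded_measurable g ->
  bounded_measurable (fun x => f x + g x).
Proof.
move=> [fr fi [M fM]] [gr gi [N gN]]; split.
- rewrite (_ : (fun x => _) = fun x => complex.Re (f x) + complex.Re (g x)).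
    exact: measurable_funD.
  by apply/funext => x; case: (f x) (g x) => ? ? [].
- rewrite (_ : (fun x => _) = fun x => complex.Im (f x) + complex.Im (g x)).
    exact: measurable_funD.
  by apply/funext => x; case: (f x) (g x) => ? ? [].
by exists (M + N) => x; rewrite rmorphD (le_trans (ler_normD _ _)) // lerD.
Qed.

Lemma bounded_measurableM f g : bounded_measurable f -> bounded_measurable g ->
  bounded_measurable (fun x => f x * g x).
Proof.
move=> [fr fi [M fM]] [gr gi [N gN]]; split.
- rewrite (_ : (fun x => _) = fun x =>
    complex.Re (f x) * complex.Re (g x) - complex.Im (f x) * complex.Im (g x)).
    by apply: measurable_funB; apply: measurable_funM.
  by apply/funext => x; case: (f x) (g x) => ? ? [].
- rewrite (_ : (fun x => _) = fun x =>
    complex.Re (f x) * complex.Im (g x) + complex.Im (f x) * complex.Re (g x)).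
    by apply: measurable_funD; apply: measurable_funM.
  by apply/funext => x; case: (f x) (g x) => ? ? [].
by exists (M * N) => x; rewrite rmorphM normrM ler_pM.
Qed.

Lemma bounded_measurable_conj f : bounded_measurable f ->
  bounded_measurable (fun x => (f x)^*).
Proof.
move=> [fr fi [M fM]]; split.
- rewrite (_ : (fun x => _) = fun x => complex.Re (f x)) //.
  by apply/funext => x; case: (f x).
- rewrite (_ : (fun x => _) = fun x => - complex.Im (f x)).
    exact: measurable_funN.
  by apply/funext => x; case: (f x).
by exists M => x; rewrite norm_conjC.
Qed.

Lemma bounded_measurable_sum (I : Type) (r : seq I) (F : I -> T -> R[i]) :
  (forall i, bounded_measurable (F i)) ->
  bounded_measurable (fun x => \sum_(i <- r) F i x).
Proof.
move=> bF; elim: r => [|i r IH].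
  by under eq_fun do rewrite big_nil; apply: bounded_measurable_cst.
by under eq_fun do rewrite big_cons; apply: bounded_measurableD.
Qed.

Lemma bounded_measurable_prod (I : Type) (r : seq I) (F : I -> T -> R[i]) :
  (forall i, bounded_measurable (F i)) ->
  bounded_measurable (fun x => \prod_(i <- r) F i x).
Proof.
move=> bF; elim: r => [|i r IH].
  by under eq_fun do rewrite big_nil; apply: bounded_measurable_cst.
by under eq_fun do rewrite big_cons; apply: bounded_measurableM.
Qed.

Lemma bounded_measurableX f n : bounded_measurable f ->
  bounded_measurable (fun x => f x ^+ n).
Proof.
move=> bf; elim: n => [|n IH].
  by under eq_fun do rewrite expr0; apply: bounded_measurable_cst.
by under eq_fun do rewrite exprS; apply: bounded_measurableM.
Qed.

Lemma bounded_measurable_cexp f : bounded_measurable f ->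
  bounded_measurable (fun x => cexp (f x)).
Proof.
move=> [fr fi [M fM]].
have mexp : measurable_fun setT (fun x => expR (complex.Re (f x))).
  exact: measurableT_comp.
have mcos : measurable_fun setT (fun x => cos (complex.Im (f x))).
  apply: measurableT_comp => //; apply: continuous_measurable_fun.
  exact: continuous_cos.
have msin : measurable_fun setT (fun x => sin (complex.Im (f x))).
  apply: measurableT_comp => //; apply: continuous_measurable_fun.
  exact: continuous_sin.
split.
- rewrite (_ : (fun x => _) =
      fun x => expR (complex.Re (f x)) * cos (complex.Im (f x))).
    exact: measurable_funM.
  by apply/funext => x; case: (f x) => a b; rewrite /cexp /= mul0r subr0.
- rewrite (_ : (fun x => _) =
      fun x => expR (complex.Re (f x)) * sin (complex.Im (f x))).
    exact: measurable_funM.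
  by apply/funext => x; case: (f x) => a b; rewrite /cexp /= mul0r addr0.
exists (expR M * 2) => x; rewrite /cexp normrM rmorphM ler_pM //.
  rewrite normc_def /= expr0n /= addr0 sqrtr_sqr lecR ger0_norm ?expR_ge0 //.
  rewrite ler_expR; have := le_trans (Re_le_norm (f x)) (fM x).
  by rewrite lecR; apply: le_trans; apply: ler_norm.
apply: le_trans (norm_ReIm_le _) _; rewrite lecR /=.
by have := cos_max (complex.Im (f x)); have := sin_max (complex.Im (f x)); lra.
Qed.

Section Charge.
Context (nu : {charge set T -> \bar R}) (X : set T) (mX : measurable X).

Lemma finite_integrable (m : {finite_measure set T -> \bar R}) (f : T -> R) M :
  measurable_fun setT f -> (forall x, `|f x| <= M) ->
  m.-integrable X (EFin \o f).
Proof.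
move=> mf fM; apply: measurable_bounded_integrable => //.
- by rewrite ltey_eq fin_num_measure.
- exact: measurable_funTS.
exists M; split; first exact: num_real.
by move=> y My x _ /=; apply: le_trans (fM x) (ltW My).
Qed.

Lemma charge_integral_lin (f g : T -> R) (a M N : R) :
  measurable_fun setT f -> measurable_fun setT g ->
  (forall x, `|f x| <= M) -> (forall x, `|g x| <= N) ->
  charge_integral nu X (fun x => a * f x + g x) =
  a * charge_integral nu X f + charge_integral nu X g.
Proof.
move=> mf mg fM gN.
have lin (m : {finite_measure set T -> \bar R}) :
    (\int[m]_(x in X) (a * f x + g x))%R =
    a * (\int[m]_(x in X) f x)%R + (\int[m]_(x in X) g x)%R.
  rewrite RintegralD // ?RintegralZl //; try exact: finite_integrable fM.
    apply: (@finite_integrable _ _ (`|a| * M)); first exact: measurable_funM.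
    by move=> x; rewrite normrM ler_wpM2l.
  exact: finite_integrable gN.
rewrite /charge_integral; cbv zeta; rewrite !lin; ring.
Qed.

(** The constant is the total variation of [nu] on [X], the sum of the masses of the two Jordan
    parts. *)
Lemma charge_integral_bound : exists2 K : R, 0 <= K &
  forall (f : T -> R) (M : R), measurable_fun setT f ->
    (forall x, `|f x| <= M) -> `|charge_integral nu X f| <= K * M.
Proof.
pose hN := projT2 (cid (projT2 (cid (Hahn_decomposition nu)))).
have bd (m : {finite_measure set T -> \bar R}) (f : T -> R) (M : R) :
    measurable_fun setT f -> (forall x, `|f x| <= M) ->
    `|(\int[m]_(x in X) f x)%R| <= fine (m X) * M.
  move=> mf fM; have If := finite_integrable m mf fM.
  apply: le_trans (le_normr_Rintegral mX If) _.
  rewrite mulrC -Rintegral_cst //; apply: le_Rintegral => //.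
    apply: (@finite_integrable _ _ M); first exact: measurableT_comp.
    by move=> x; rewrite normr_id.
  apply: (@finite_integrable _ _ `|M|); first exact: measurable_cst.
  by move=> x.
exists (fine (jordan_pos hN X) + fine (jordan_neg hN X)).
  by rewrite addr_ge0 // fine_ge0.
move=> f M mf fM; apply: le_trans (ler_normB _ _) _; rewrite mulrDl.
by apply: lerD; apply: bd.
Qed.

End Charge.

Section ComplexMeasure.
Context (mu : @complex_measure R d T) (X : set T) (mX : measurable X).

Lemma cintegral_lin c f g : bounded_measurable f -> bounded_measurable g ->
  cintegral mu X (fun x => c * f x + g x) =
  c * cintegral mu X f + cintegral mu X g.
Proof.
move=> [fr fi [M fM]] [gr gi [N gN]].
have Mr x : `|complex.Re (f x)| <= M.
  by rewrite -lecR (le_trans (Re_le_norm _)).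
have Mi x : `|complex.Im (f x)| <= M.
  by rewrite -lecR (le_trans (Im_le_norm _)).
have Nr x : `|complex.Re (g x)| <= N.
  by rewrite -lecR (le_trans (Re_le_norm _)).
have Ni x : `|complex.Im (g x)| <= N.
  by rewrite -lecR (le_trans (Im_le_norm _)).
case: c => a b; rewrite /cintegral.
have lin2 (nu : {charge set T -> \bar R}) (u v w : T -> R) (k l P Q : R) :
    measurable_fun setT u -> measurable_fun setT v -> measurable_fun setT w ->
    (forall x, `|u x| <= P) -> (forall x, `|v x| <= P) ->
    (forall x, `|w x| <= Q) ->
    charge_integral nu X (fun x => k * u x + (l * v x + w x)) =
    k * charge_integral nu X u +
    (l * charge_integral nu X v + charge_integral nu X w).
  move=> mu' mv mw uP vP wQ.
  rewrite (@charge_integral_lin nu X mX u (fun x => l * v x + w x) k P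
    (`|l| * P + Q)) //; first by rewrite (charge_integral_lin _ _ _ _ _ vP wQ).
    by apply: measurable_funD => //; apply: measurable_funM.
  move=> x; apply: le_trans (ler_normD _ _) _; rewrite lerD // normrM.
  by rewrite ler_wpM2l.
have -> : (fun x => complex.Re ((a +i* b)%C * f x + g x)) = fun x =>
    a * complex.Re (f x) + ((- b) * complex.Im (f x) + complex.Re (g x)).
  by apply/funext => x; case: (f x) (g x) => ? ? [? ?] /=; ring.
have -> : (fun x => complex.Im ((a +i* b)%C * f x + g x)) = fun x =>
    a * complex.Im (f x) + (b * complex.Re (f x) + complex.Im (g x)).
  by apply/funext => x; case: (f x) (g x) => ? ? [? ?] /=; ring.
rewrite !(lin2 _ _ _ _ _ _ M N) //.
by apply/eqP; rewrite eq_complex /=; apply/andP; split; apply/eqP; ring.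
Qed.

Lemma cintegral0 : cintegral mu X (fun=> 0) = 0.
Proof.
have b0 := bounded_measurable_cst 0.
have := cintegral_lin 1 b0 b0.
under eq_fun do rewrite mulr0 addr0.
by move/eqP; rewrite mul1r -subr_eq0 opprD addNKr oppr_eq0 => /eqP.
Qed.

Lemma cintegral_comb (I : Type) (r : seq I) (c : I -> R[i])
    (F : I -> T -> R[i]) :
  (forall i, bounded_measurable (F i)) ->
  cintegral mu X (fun x => \sum_(i <- r) c i * F i x) =
  \sum_(i <- r) c i * cintegral mu X (F i).
Proof.
move=> bF; elim: r => [|i r IH].
  by under eq_fun do rewrite big_nil; rewrite big_nil cintegral0.
under eq_fun do rewrite big_cons; rewrite big_cons cintegral_lin // ?IH //.
apply: bounded_measurable_sum => j.
by apply: bounded_measurableM => //; apply: bounded_measurable_cst.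
Qed.

Lemma cintegral_bound : exists2 K : R, 0 <= K &
  forall f (M : R), bounded_measurable f -> (forall x, `|f x| <= M%:C%C) ->
    `|cintegral mu X f| <= (K * M)%:C%C.
Proof.
have [K K0 hK] := charge_integral_bound (cm_re mu) mX.
have [L L0 hL] := charge_integral_bound (cm_im mu) mX.
exists (2 * (K + L)); first by rewrite mulr_ge0 ?addr_ge0.
move=> f M [fr fi _] fM; apply: le_trans (norm_ReIm_le _) _; rewrite lecR /=.
have Mr x : `|complex.Re (f x)| <= M.
  by rewrite -lecR (le_trans (Re_le_norm _)).
have Mi x : `|complex.Im (f x)| <= M.
  by rewrite -lecR (le_trans (Im_le_norm _)).
apply: le_trans (lerD (ler_normB _ _) (ler_normD _ _)) _.
have := hK _ _ fr Mr; have := hK _ _ fi Mi.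
by have := hL _ _ fr Mr; have := hL _ _ fi Mi; lra.
Qed.

(* Differentiation under the integral sign, with the quadratic remainder that
   the complex derivative needs. *)
Lemma cintegral_cexp_quadratic f w : bounded_measurable f ->
  bounded_measurable w -> (forall x, `|w x| <= 1) ->
  exists2 K : R, 0 <= K & forall s : R[i], `|s| < (2^-1)%:C%C ->
    `|cintegral mu X (fun x => f x * cexp (s * w x)) - cintegral mu X f -
      s * cintegral mu X (fun x => f x * w x)| <= K%:C%C * `|s| ^+ 2.
Proof.
move=> bf bw w1; have [K K0 hK] := cintegral_bound.
(* The 5 comes from [cexp_sub_le]; the absolute value makes the bound nonnegative whatever the sign
   of [M]. *)
have [_ _ [M fM]] := bf; exists (K * (`|M| * 5)).
  by rewrite !mulr_ge0.
move=> s s2; have bsw : bounded_measurable (fun x => s * w x).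
  by apply: bounded_measurableM => //; apply: bounded_measurable_cst.
have bfw := bounded_measurableM bf bw.
have bfe := bounded_measurableM bf (bounded_measurable_cexp bsw).
have bffw := bounded_measurableD
  (bounded_measurableM (bounded_measurable_cst s) bfw) bf.
have -> : cintegral mu X (fun x => f x * cexp (s * w x)) - cintegral mu X f -
      s * cintegral mu X (fun x => f x * w x) =
    cintegral mu X (fun x => f x * (cexp (s * w x) - 1 - s * w x)).
  transitivity (-1 * (s * cintegral mu X (fun x => f x * w x) + cintegral mu X f)
    + cintegral mu X (fun x => f x * cexp (s * w x))); first by ring.
  rewrite -(cintegral_lin s bfw bf) -(cintegral_lin (-1) bffw bfe).
  by congr cintegral; apply/funext => x; ring.
(* The norm takes values in [R[i]], while the integral bound expects a real constant. *)
have [m es] : exists m : R, `|s| = m%:C%C.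
  by exists (Num.sqrt (complex.Re s ^+ 2 + complex.Im s ^+ 2)); rewrite normc_def.
rewrite es -rmorphXn -rmorphM -!mulrA; apply: hK.
  rewrite (_ : (fun x => _) = fun x => f x * cexp (s * w x) +
    (-1) * (s * (f x * w x) + f x)); last by apply/funext => x; ring.
  apply: bounded_measurableD => //.
  by apply: bounded_measurableM => //; apply: bounded_measurable_cst.
move=> x; rewrite normrM rmorphM ler_pM //.
  by apply: le_trans (fM x) _; rewrite lecR ler_norm.
have sw : `|s * w x| <= `|s| by rewrite normrM ler_piMr.
apply: le_trans (cexp_sub_le _) _; first exact: le_trans sw (ltW s2).
rewrite rmorphM rmorph_nat ler_wpM2l // rmorphXn -[X in _ <= X ^+ 2]es.
by rewrite ler_sqr ?nnegrE.
Qed.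

End ComplexMeasure.
End BoundedIntegrands.

(** * Moment matrices on the torus *)

Section TorusMoments.
Context {R : realType} {D : nat}.
Local Notation C := R[i].
Implicit Types (al be ga c : midx D) (th : angles R D) (t : times R D).
Implicit Types (m : mexp D) (n : 'M[C]_(D + D)) (q : 'I_(D + D) -> C).

Lemma measurable_torus : measurable (@torus R D).
Proof.
have -> : @torus R D = (\bigcap_(a in [set: 'I_D])
    ((fun th => tnth th a) @^-1` `[0, pi *+ 2[))%classic.
  apply/seteqP; split=> th /= h a => [_|]; first by rewrite /= in_itv /= h.
  by have := h a I; rewrite /= in_itv.
apply: fin_bigcap_measurable => // a _.
rewrite -[X in measurable X]setTI; apply: measurable_tnth => //.
Qed.

Lemma norm_zpt th a : `|zpt th a| = 1 :> C.
Proof.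
rewrite /zpt /cexp /= expR0 mul1r normc_def /= cos2Dsin2 sqrtr1.
by [].
Qed.

Lemma zpt_neq0 th a : zpt th a != 0 :> C.
Proof. by rewrite -normr_eq0 norm_zpt oner_eq0. Qed.

Lemma conj_zpt th a : (zpt th a)^* = (zpt th a)^-1 :> C.
Proof. by rewrite [RHS]invC_norm norm_zpt expr1n invr1 mul1r. Qed.

Lemma bounded_measurable_zpt a :
  bounded_measurable (fun th : angles R D => zpt th a : C).
Proof.
have mth : measurable_fun setT (fun th : angles R D => tnth th a).
  exact: measurable_tnth.
split; last by exists 1 => th; rewrite norm_zpt.
- rewrite (_ : (fun th => _) = fun th => cos (tnth th a)).
    apply: measurableT_comp => //; apply: continuous_measurable_fun.
    exact: continuous_cos.
  by apply/funext => th; rewrite /zpt /cexp /= expR0 mul0r subr0 mul1r.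
- rewrite (_ : (fun th => _) = fun th => sin (tnth th a)).
    apply: measurableT_comp => //; apply: continuous_measurable_fun.
    exact: continuous_sin.
  by apply/funext => th; rewrite /zpt /cexp /= expR0 mul0r addr0 mul1r.
Qed.

Lemma zmonD th al be : zmon (zpt th) (al + be) =
  zmon (zpt th) al * zmon (zpt th) be :> C.
Proof.
rewrite /zmon -big_split /=; apply: eq_bigr => a _.
by rewrite ffunE expfzDr // zpt_neq0.
Qed.

Lemma conj_zmon th al : (zmon (zpt th) al)^* = zmon (zpt th) (- al) :> C.
Proof.
rewrite /zmon rmorph_prod; apply: eq_bigr => a _.
by rewrite ffunE /= -exprz_inv -conj_zpt rmorphXz // unitfE zpt_neq0.
Qed.

Lemma norm_zmon th al : `|zmon (zpt th) al| = 1 :> C.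
Proof.
apply/eqP; rewrite -(@eqrXn2 _ 2) // normCK conj_zmon -zmonD subrr expr1n.
by rewrite /zmon big1 // => a _; rewrite ffunE expr0z.
Qed.

Lemma zmon_unit th (b : 'I_D) : zmon (zpt th) (unitidx b) = zpt th b :> C.
Proof.
rewrite /zmon (bigD1 b) //= ffunE eqxx expr1z big1 ?mulr1 // => a /negPf ab.
by rewrite ffunE ab expr0z.
Qed.

Lemma zmon_unitN th (b : 'I_D) :
  zmon (zpt th) (- unitidx b) = (zpt th b)^-1 :> C.
Proof. by rewrite -conj_zmon zmon_unit conj_zpt. Qed.

(** Negative powers are powers of the conjugate on the torus, so boundedness and measurability
    follow without inverting a function. *)
Lemma bounded_measurable_zmon al :
  bounded_measurable (fun th : angles R D => zmon (zpt th) al : C).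
Proof.
apply: bounded_measurable_prod => a; case: (al a) => k.
  exact: bounded_measurableX (bounded_measurable_zpt a).
have -> : (fun th : angles R D => zpt th a ^ Negz k : C) =
    fun th => (zpt th a)^* ^+ k.+1.
  by apply/funext => th; rewrite conj_zpt NegzE -exprz_inv.
apply: bounded_measurableX; apply: bounded_measurable_conj.
exact: bounded_measurable_zpt.
Qed.

(** * Time polynomials, weights and moments *)

Lemma tpolyE t (r : seq (midx D)) (z : 'I_D -> C) : uniq r ->
  (forall al, t al != 0 -> al \in r) ->
  tpoly t z = \sum_(al <- r) t al * zmon z al.
Proof.
move=> ur tr; rewrite /tpoly (fsbigE r) //.
  by apply: eq_bigl => al; rewrite in_setT.
move=> al _ alr; suff -> : t al = 0 by rewrite mul0r.
by apply/eqP; apply: contraNT alr => /tr.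
Qed.

Lemma finite_timesP t : finite_times t ->
  exists2 r : seq (midx D), uniq r & forall al, t al != 0 -> al \in r.
Proof.
move=> /finite_seqP[r er]; exists (undup r); first exact: undup_uniq.
move=> al tal; rewrite mem_undup.
by have : [set al | t al != 0]%classic al by []; rewrite er.
Qed.

Lemma tpoly_tshift t c s (z : 'I_D -> C) : finite_times t ->
  tpoly (tshift t c s) z = tpoly t z + s * zmon z c.
Proof.
move=> /finite_timesP[r0 _ tr0].
(* The list has to contain [c], where the shifted time may be nonzero although [t c] is 0. *)
have [r [ur cr tr]] : exists r,
    [/\ uniq r, c \in r & forall al, t al != 0 -> al \in r].
  exists (undup (c :: r0)); split; first exact: undup_uniq.
    by rewrite mem_undup mem_head.
  by move=> al /tr0 alr; rewrite mem_undup inE alr orbT.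
rewrite (tpolyE z ur tr) (@tpolyE _ r z ur); last first.
  move=> al; have [-> _ //|/negPf ne] := eqVneq al c.
  by rewrite /tshift ne => /tr.
rewrite (bigD1_seq c) //= [in RHS](bigD1_seq c) //=.
under eq_bigr => al /negPf alc do rewrite /tshift alc.
by rewrite /tshift eqxx mulrDl addrAC.
Qed.

Definition weight n q t m th : C :=
  cexp (tpoly t (zpt th)) * \prod_a (Lpoly n a (zpt th) - q a) ^+ m a.

Lemma bounded_measurable_Lpoly n a :
  bounded_measurable (fun th : angles R D => Lpoly n a (zpt th)).
Proof.
apply: bounded_measurable_sum => b; apply: bounded_measurableD;
  apply: bounded_measurableM; try exact: bounded_measurable_cst.
  under eq_fun do rewrite -conj_zpt; apply: bounded_measurable_conj.
  exact: bounded_measurable_zpt.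
exact: bounded_measurable_zpt.
Qed.

Lemma bounded_measurable_weight n q t m : finite_times t ->
  bounded_measurable (weight n q t m).
Proof.
move=> /finite_timesP[r ur tr]; apply: bounded_measurableM.
  apply: bounded_measurable_cexp; under eq_fun do rewrite (tpolyE _ ur tr).
  apply: bounded_measurable_sum => al; apply: bounded_measurableM.
    exact: bounded_measurable_cst.
  exact: bounded_measurable_zmon.
apply: bounded_measurable_prod => a; apply: bounded_measurableX.
apply: bounded_measurableD; first exact: bounded_measurable_Lpoly.
exact: bounded_measurable_cst.
Qed.

Context (mu : complex_measure R (angles R D)).

Definition moment n q t m al : C :=
  cintegral mu torus (fun th => zmon (zpt th) al * weight n q t m th).

(** On the torus conjugation inverts monomials, so the two outer monomials merge into one; this is
    the source of the Toeplitz property. *)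
Lemma GmxE n q t m al be : Gmx mu n q t m al be = moment n q t m (al - be).
Proof.
congr cintegral; apply/funext => th.
cbv zeta; rewrite conj_zmon zmonD /weight; ring.
Qed.

Lemma Gmx_toeplitz n q t m : toeplitz (Gmx mu n q t m).
Proof.
move=> al be c; rewrite !GmxE; congr (moment _ _ _ _ _).
by rewrite opprD addrACA subrr addr0.
Qed.

Lemma bounded_measurable_integrand n q t m al : finite_times t ->
  bounded_measurable (fun th => zmon (zpt th) al * weight n q t m th).
Proof.
move=> ft; apply: bounded_measurableM; first exact: bounded_measurable_zmon.
exact: bounded_measurable_weight.
Qed.

(** Indexing the signed directions by a sum type turns the Laurent polynomial, [nu] and the
    directional derivatives into single finite sums. *)
Definition Lcoef n a (i : 'I_D + 'I_D) : C :=
  match i with inl b => nneg n a b | inr b => npos n a b end.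

Definition Ldir (i : 'I_D + 'I_D) : midx D :=
  match i with inl b => - unitidx b | inr b => unitidx b end.

Lemma LpolyE n a th :
  Lpoly n a (zpt th) = \sum_i Lcoef n a i * zmon (zpt th) (Ldir i).
Proof.
rewrite big_sumType /= -big_split /=; apply: eq_bigr => b _.
by rewrite zmon_unit zmon_unitN.
Qed.

Lemma nuE n a al be :
  nu n a al be = \sum_i Lcoef n a i * (al + Ldir i == be)%:R.
Proof.
rewrite big_sumType /= -big_split /=; apply: eq_bigr => b _.
rewrite /Upsilon_inv /Upsilon subr_eq (eq_sym (be + _)).
by do 2 case: (_ == _).
Qed.

(** Only one coordinate moves, by one unit, and the absolute value of an integer then changes by
    exactly one. *)
Lemma mlen_Ldir al i :
  mlen (al + Ldir i) = (mlen al).+1 \/ mlen al = (mlen (al + Ldir i)).+1.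
Proof.
pose b := match i with inl b | inr b => b end.
have ib (x : 'I_D) : x != b -> (al + Ldir i) x = al x.
  by rewrite /b => /negPf xb; rewrite ffunE; case: i b xb => y /= _ xy;
    rewrite !ffunE xy ?oppr0 addr0.
have mE ga : mlen ga = (`|ga b|%N + \sum_(x < D | x != b) `|ga x|%N)%N.
  by rewrite /mlen (bigD1 b).
rewrite !mE.
rewrite (eq_bigr (fun x => `|al x|%N)); last by move=> x /ib ->.
have : (al + Ldir i) b = al b - 1 \/ (al + Ldir i) b = al b + 1.
  by rewrite ffunE /b; case: i {b ib mE} => b /=; rewrite !ffunE eqxx; [left|right].
move: (\sum_(_ | _) _)%N ((al + Ldir i) b) (al b) => x y z; lia.
Qed.

Lemma nu_nearest n a : nearest_neighbour (nu n a).
Proof.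
move=> al be; rewrite nuE => /eqP ne.
have [/existsP[i /eqP <-]|/existsPn h] := boolP [exists i, al + Ldir i == be].
  exact: mlen_Ldir.
by case: ne; rewrite big1 // => i _; rewrite (negPf (h i)) mulr0.
Qed.

Lemma nu_toeplitz n a : toeplitz (nu n a).
Proof.
move=> al be c; rewrite !nuE; apply: eq_bigr => i _.
by rewrite addrAC (inj_eq (addIr c)).
Qed.

Lemma smul_nu n a (A : smx R D) al be :
  smul (nu n a) A al be = \sum_i Lcoef n a i * A (al + Ldir i) be.
Proof.
have bnu := nearest_band (@nu_nearest n a).
rewrite (smul_bandE (k := (mlen al).+2) _ _ bnu) ?addn1 //.
under eq_bigr do rewrite nuE mulr_suml; rewrite exchange_big /=.
apply: eq_bigr => i _; rewrite (bigD1_seq (al + Ldir i)) ?uniq_blocks_lt //=.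
  rewrite eqxx mulr1 big1 ?addr0 // => c /negPf; rewrite eq_sym => ->.
  by rewrite mulr0 mul0r.
by rewrite mem_blocks_lt; have := mlen_Ldir al i; lia.
Qed.

(** The shift inserts the factor [Lpoly n a z - q a] into the weight, and each monomial of [Lpoly]
    translates the row index of the moment matrix. *)
Lemma Gmx_mshift n q t m a : finite_times t -> forall al be,
  Gmx mu n q t (mshift m a) al be =
  smul (nu n a) (Gmx mu n q t m) al be - q a * Gmx mu n q t m al be.
Proof.
move=> ft al be; rewrite smul_nu !GmxE.
have wE th : weight n q t (mshift m a) th =
    (Lpoly n a (zpt th) - q a) * weight n q t m th.
  rewrite /weight mulrCA; congr (_ * _).
  rewrite (bigD1 a) //= [in RHS](bigD1 a) //= mulrA; congr (_ * _).
    by rewrite ffunE eqxx addn1 exprS.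
  by apply: eq_bigr => b /negPf ba; rewrite ffunE ba addn0.
have bi := bounded_measurable_integrand n q m _ ft.
rewrite (eq_bigr (fun i => Lcoef n a i * moment n q t m (al - be + Ldir i)));
  last by move=> i _; rewrite GmxE addrAC.
rewrite [RHS]addrC -mulNr /moment -(cintegral_comb mu measurable_torus) //.
rewrite -(cintegral_lin mu measurable_torus) //; last first.
  apply: bounded_measurable_sum => i.
  by apply: bounded_measurableM => //; apply: bounded_measurable_cst.
congr cintegral; apply/funext => th; rewrite wE LpolyE mulrBl mulrBr addrC.
congr (_ + _); first by ring.
rewrite mulr_suml mulr_sumr; apply: eq_bigr => i _.
by rewrite [zmon _ (_ + Ldir i)]zmonD; ring.
Qed.

Lemma tshift0 t c : tshift t c 0 = t.
Proof. by apply/funext => al; rewrite /tshift; case: eqP; rewrite ?addr0. Qed.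

(** Shifting the time multiplies the weight by [cexp (s * z^c)], and [z^c] has modulus 1 on the
    torus. *)
Lemma Gmx_quadratic n q t m c al be : finite_times t ->
  exists2 K : C, 0 <= K & forall s : C, `|s| < (2^-1)%:C%C ->
    `|Gmx mu n q (tshift t c s) m al be - Gmx mu n q t m al be -
      s * Gmx mu n q t m (al + c) be| <= K * `|s| ^+ 2.
Proof.
move=> ft; have [|K K0 hK] := cintegral_cexp_quadratic mu measurable_torus
  (bounded_measurable_integrand n q m (al - be) ft)
  (bounded_measurable_zmon c).
  by move=> th; rewrite norm_zmon.
exists K%:C%C => [|s s2]; first by rewrite lecR.
have -> : Gmx mu n q (tshift t c s) m al be = cintegral mu torus (fun th =>
    zmon (zpt th) (al - be) * weight n q t m th * cexp (s * zmon (zpt th) c)).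
  rewrite GmxE; congr cintegral; apply/funext => th.
  by rewrite /weight tpoly_tshift // cexpD; ring.
have -> : Gmx mu n q t m (al + c) be = cintegral mu torus (fun th =>
    zmon (zpt th) (al - be) * weight n q t m th * zmon (zpt th) c).
  rewrite GmxE addrAC; congr cintegral; apply/funext => th.
  by rewrite [zmon _ (_ + c)]zmonD mulrAC.
by rewrite GmxE; apply: hK.
Qed.

Lemma Gmx_cderive n q t m c al be : finite_times t ->
  cderivable (fun s : C => Gmx mu n q (tshift t c s) m al be) 0 /\
  cderive (fun s : C => Gmx mu n q (tshift t c s) m al be) 0 =
  Gmx mu n q t m (al + c) be.
Proof.
move=> /(Gmx_quadratic n q m c al be)[K K0 hK].
apply: (cderive_quadratic K0 (d := (2^-1)%:C%C)) => [|s].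
  by rewrite ltcR invr_gt0.
by rewrite tshift0; apply: hK.
Qed.

(** The conjugation of [s] and that of the entry compensate, so the remainder is the conjugate of
    the one in [Gmx_quadratic] at [s^*]. *)
Lemma Gmx_cderivebar n q t m c al be : finite_times t ->
  cderivable (fun s : C => sadj (Gmx mu n q (tshift t c s^*) m) al be) 0 /\
  cderive (fun s : C => sadj (Gmx mu n q (tshift t c s^*) m) al be) 0 =
  (Gmx mu n q t m (be + c) al)^*.
Proof.
move=> /(Gmx_quadratic n q m c be al)[K K0 hK].
apply: (cderive_quadratic K0 (d := (2^-1)%:C%C)) => [|s s2].
  by rewrite ltcR invr_gt0.
rewrite conjC0 tshift0 /sadj -[s in s * _]conjCK -rmorphM -!rmorphB norm_conjC.
by rewrite -[`|s|]norm_conjC; apply: hK; rewrite norm_conjC.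
Qed.

End TorusMoments.

(** * The bracket formula *)

Section BracketFormula.
Context {R : realType} {D : nat}.
Local Notation C := R[i].
Context (mu : complex_measure R (angles R D)) (n : 'M[C]_(D + D))
  (q : 'I_(D + D) -> C) (Om : times R D -> mexp D -> Prop)
  (S H Sh : times R D -> mexp D -> smx R D).
Context (Om_open : open_in_times Om)
  (Om_finite : forall t m, Om t m -> finite_times t)
  (Om_qd : forall t m, Om t m -> quasi_definite (Gmx mu n q t m))
  (fact : forall t m, Om t m ->
     gauss_factorization (Gmx mu n q t m) (S t m) (H t m) (Sh t m)).

Lemma open_in_Ldir t m : Om t m -> exists2 e : R, 0 < e &
  forall i (s : C), `|s| < e%:C%C -> Om (tshift t (Ldir i) s) m.
Proof.
move=> /Om_open[e e0 he]; exists e => // -[] b s /(he b)[] //.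
Qed.

(** The flows run in the directions [Ldir i]; openness of [Om] provides the factorization for all
    small [s]. *)
Lemma bracketE a t m : Om t m -> Om t (mshift m a) ->
  bracket n q (fun t m => subdiag (S t m)) a t m =
  smul (subdiag2 (S t (mshift m a)) - subdiag2 (S t m)) (upper (nu n a)).
Proof.
move=> Omm Oma; have ft := Om_finite Omm.
have [SG _] := gauss_orthogonal (fact Omm).
have [SG' _] := gauss_orthogonal (fact Oma).
have [uS _ _ _] := fact Omm; have [uS' _ _ _] := fact Oma.
rewrite -(bracket_of_flow (c := Lcoef n a) (q := q a)
  (Gs := fun i s => Gmx mu n q (tshift t (Ldir i) s) m)
  (Ss := fun i s => S (tshift t (Ldir i) s) m)
  (dG := fun i al be => Gmx mu n q t m (al + Ldir i) be)
  (@nu_nearest _ _ n a) (Om_qd Omm) uS uS' SG SG') //.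
- congr (_ + _); apply/funext => al; apply/funext => be.
  by rewrite /pdn big_sumType /= -big_split.
- exact: Gmx_mshift.
- by move=> i; rewrite tshift0.
- by move=> i; rewrite tshift0.
- have [e e0 he] := open_in_Ldir Omm => i.
  exists e%:C%C => [|s /(he i) Oms]; first by rewrite ltcR.
  have [? _ _ _] := fact Oms; have [? _] := gauss_orthogonal (fact Oms).
  by split => //; apply: Om_qd.
- by move=> i al be; apply: Gmx_cderive.
- by move=> al be; rewrite smul_nu.
Qed.

Lemma bracketbarE a t m : Om t m -> Om t (mshift m a) ->
  bracketbar n q (fun t m => subdiag (Sh t m)) a t m =
  smul (subdiag2 (Sh t (mshift m a)) - subdiag2 (Sh t m))
       (upper (sadj (nu n a))).
Proof.
move=> Omm Oma; have ft := Om_finite Omm.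
have [_ SG] := gauss_orthogonal (fact Omm).
have [_ SG'] := gauss_orthogonal (fact Oma).
have [_ uS _ _] := fact Omm; have [_ uS' _ _] := fact Oma.
(* The adjoint of [nu G] has the adjoint of [nu] on the right; commutation of Toeplitz matrices
   brings it to the left, where [bracket_of_flow] expects it. *)
have GN : smul (sadj (nu n a)) (sadj (Gmx mu n q t m)) =
    sadj (smul (nu n a) (Gmx mu n q t m)).
  rewrite (smul_sadj _ (nearest_band (@nu_nearest _ _ n a))).
  apply: toeplitz_comm => al be ga; rewrite /sadj; congr (_^*).
    exact: nu_toeplitz.
  exact: Gmx_toeplitz.
rewrite -(bracket_of_flow (c := fun i => (Lcoef n a i)^*) (q := (q a)^*)
  (Gs := fun i s => sadj (Gmx mu n q (tshift t (Ldir i) s^*) m))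
  (Ss := fun i s => Sh (tshift t (Ldir i) s^*) m)
  (dG := fun i al be => (Gmx mu n q t m (be + Ldir i) al)^*)
  (sadj_nearest (@nu_nearest _ _ n a)) (quasi_definite_sadj (Om_qd Omm))
  uS uS' SG SG') //.
- congr (_ + _); apply/funext => al; apply/funext => be.
  by rewrite /pdnbar big_sumType /= -big_split.
- move=> al be; rewrite GN /sadj -rmorphM -rmorphB; congr (_^*).
  exact: Gmx_mshift.
- by move=> i; rewrite conjC0 tshift0.
- by move=> i; rewrite conjC0 tshift0.
- have [e e0 he] := open_in_Ldir Omm => i.
  exists e%:C%C => [|s]; first by rewrite ltcR.
  rewrite -norm_conjC => /(he i) Oms.
  have [_ ? _ _] := fact Oms; have [_ ?] := gauss_orthogonal (fact Oms).
  by split => //; apply: quasi_definite_sadj; apply: Om_qd.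
- by move=> i al be; apply: Gmx_cderivebar.
- move=> al be; rewrite GN /sadj smul_nu rmorph_sum; apply: eq_bigr => i _.
  by rewrite rmorphM.
Qed.

End BracketFormula.

(** * Commutation of the discrete shifts and the nonlinear equations *)

Lemma mshiftC D (m : mexp D) a b :
  mshift (mshift m a) b = mshift (mshift m b) a.
Proof. by apply/ffunP => c; rewrite !ffunE addnAC. Qed.

(* Once each bracket is [(Delta_a X) N_a], both sides are
   [(Delta_a Delta_b X) N_a N_b]. *)
Lemma Delta_bracket_comm (R : realType) (D : nat)
    (X0 Xa Xb Xab Na Nb : smx R D) :
  bandwidth 0 X0 -> bandwidth 0 Xa -> bandwidth 0 Xb -> bandwidth 0 Xab ->
  bandwidth 1 Na -> bandwidth 1 Nb -> smul Na Nb = smul Nb Na ->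
  smul (smul (Xab - Xb) Na - smul (Xa - X0) Na) Nb =
  smul (smul (Xab - Xa) Nb - smul (Xb - X0) Nb) Na.
Proof.
move=> b0 ba bb bab bNa bNb NN.
have [bX bY] := (bandwidthB bab bb, bandwidthB ba b0).
have [bZ bW] := (bandwidthB bab ba, bandwidthB bb b0).
rewrite -(smulBl _ bX bY) -(smulBl _ bZ bW).
rewrite -(smulA _ (bandwidthB bX bY) bNa) -(smulA _ (bandwidthB bZ bW) bNb) NN.
suff -> : Xab - Xb - (Xa - X0) = Xab - Xa - (Xb - X0) by [].
by rewrite !opprB addrACA [RHS]addrACA [- Xb + _]addrC.
Qed.

Theorem theorem4p4 (R : realType) (D : nat) (D_ge1 : (1 <= D)%N)
    (mu : complex_measure R (angles R D))
    (n : 'M[R[i]]_(D + D)) (n_free : row_free n)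
    (q : 'I_(D + D) -> R[i])
    (Om : times R D -> mexp D -> Prop)
    (Om_open : open_in_times Om)
    (Om_finite : forall t m, Om t m -> finite_times t)
    (Om_qd : forall t m, Om t m -> quasi_definite (Gmx mu n q t m))
    (S H Sh : times R D -> mexp D -> smx R D)
    (fact : forall t m, Om t m ->
      gauss_factorization (Gmx mu n q t m) (S t m) (H t m) (Sh t m)) :
  let beta := fun t m => subdiag (S t m) in
  let betah := fun t m => subdiag (Sh t m) in
  forall (a b : 'I_(D + D)) (t : times R D) (m : mexp D),
    Om t m -> Om t (mshift m a) -> Om t (mshift m b) ->
    Om t (mshift (mshift m a) b) ->
    smul (Delta b (bracket n q beta a) t m) (upper (nu n b)) =
    smul (Delta a (bracket n q beta b) t m) (upper (nu n a)) /\
    smul (Delta b (bracketbar n q betah a) t m) (upper (sadj (nu n b))) =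
    smul (Delta a (bracketbar n q betah b) t m) (upper (sadj (nu n a))).
Proof.
move=> beta betah a b t m Om0 Oma Omb Omab.
have Omba : Om t (mshift (mshift m b) a) by rewrite mshiftC.
(* The full matrices commute because they are Toeplitz; truncation to the upper part destroys that
   property, so commutation is transferred by [upper_comm]. *)
have comm := upper_comm (@nu_nearest _ _ n a) (@nu_nearest _ _ n b)
  (toeplitz_comm (@nu_toeplitz _ _ n a) (@nu_toeplitz _ _ n b)).
have nua c : nearest_neighbour (sadj (nu n c)).
  exact/sadj_nearest/nu_nearest.
have commh : smul (upper (sadj (nu n a))) (upper (sadj (nu n b))) =
    smul (upper (sadj (nu n b))) (upper (sadj (nu n a))).
  apply: upper_comm => //; apply: toeplitz_comm => al be ga;
    by rewrite /sadj nu_toeplitz.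
split; rewrite /Delta.
  rewrite !(bracketE Om_open Om_finite Om_qd fact) // (mshiftC m b a).
  by apply: Delta_bracket_comm; rewrite ?comm //; (exact: subdiag2_band ||
    exact/upper_band/nu_nearest).
rewrite !(bracketbarE Om_open Om_finite Om_qd fact) // (mshiftC m b a).
by apply: Delta_bracket_comm; rewrite ?commh //; (exact: subdiag2_band ||
  exact/upper_band).
Qed.
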